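(* Let $\Omega\subset\mathbb{C}^n$ be a P-hyperconvex domain and let $f:\partial\Omega\to[-\infty,\infty)$ be a function. Then the Dirichlet problem \[ \begin{cases} v \in \mathcal{PSH}(\overline{\Omega}),\\ v=f \text{ on } \partial \Omega, \end{cases} \] has a solution $v$ if and only if $f \in \mathcal{PSH}(\partial \Omega)$. Moreover, if the problem is solvable and $f \in C(\partial \Omega)$, then a solution $v$ can be chosen to belong to $C(\overline{\Omega})$.
   Context: A domain is a connected open set. Upper semicontinuous functions take values in $[-\infty,\infty)$. For a compact set $X\subset\mathbb{C}^n$ (used here for both $X=\overline{\Omega}$ and $X=\partial\Omega$): - $\mathcal{PSH}^o(X)$ is the set of functions $u$ on $X$ for which there exist an open set $U\supset X$ and a function $\tilde u$, plurisubharmonic and continuous on $U$, with $\tilde u|_X=u$. - For $z\in X$, the set $\mathcal{J}_z(X)$ of Jensen measures for $z$ is the set of all (regular Borel) probability measures $\mu$ on $X$ such that $u(z)\le\int u\,d\mu$ for all $u\in\mathcal{PSH}^o(X)$. - $\mathcal{PSH}(X)$, the set of plurisubharmonic functions on the compact set $X$, is the set of all upper semicontinuous functions $u$ on $X$ such that $u(z)\le\int u\,d\mu$ for every $z\in X$ and every $\mu\in\mathcal{J}_z(X)$. A bounded domain $\Omega\subset\mathbb{C}^n$ is called P-hyperconvex if there is a non-constant function $\phi\in\mathcal{PSH}(\overline{\Omega})\cap C(\overline{\Omega})$ such that $\phi(z)=0$ for all $z\in\partial\Omega$. *)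

(* Defs.v *)
(* C^n is the space 'rV[R[i]]_n of row vectors over the complex numbers R[i],
   R : realType.  Functions defined on a subset X of a type T are represented
   by total functions on T; every notion below "on X" depends only on the
   values taken on X. *)
From HB Require Import structures.
From mathcomp Require Import all_boot all_order all_algebra.
From mathcomp Require Import all_classical all_reals all_analysis.
From mathcomp Require Export complex.

Set Implicit Arguments.
Unset Strict Implicit.
Unset Printing Implicit Defensive.

Import Order.TTheory GRing.Theory Num.Theory.
Import numFieldNormedType.Exports.

Local Open Scope classical_set_scope.
Local Open Scope ring_scope.
Local Open Scope complex_scope.

(* R[i] does not come with a topology; it receives the one of its modulus.
   The library then equips 'rV[R[i]]_n with the sup norm, which induces the
   usual topology of C^n. *)
HB.instance Definition _ (R : realType) := NormedModule.copy R[i] R[i]^o.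

Definition boundary (T : topologicalType) (A : set T) : set T :=
  closure A `\` interior A.

Section FunctionsOnSets.
Context {R : realType} {T : topologicalType}.
Implicit Types (X : set T) (u : T -> \bar R).

(* Upper semicontinuous functions take values in [-oo, +oo[. *)
Definition usc_on X u : Prop :=
  forall z, X z -> (u z < +oo)%E /\
    forall a : R, (u z < a%:E)%E -> \forall y \near within X (nbhs z), (u y < a%:E)%E.

(* C(X) consists of finite-valued functions. *)
Definition cont_on X u : Prop :=
  (forall z, X z -> u z \is a fin_num) /\ {within X, continuous (fine \o u)}.

End FunctionsOnSets.

Section Plurisubharmonic.
Context {R : realType}.

Definition circle_point (a : R[i]) (r t : R) : R[i] :=
  a + r%:C * (cos t +i* sin t).

(* The integral is well defined, possibly -oo, when u is upper semicontinuous
   on the circle, since u is then bounded above there. *)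
Definition circle_mean (u : R[i] -> \bar R) (a : R[i]) (r : R) : \bar R :=
  (((2 * pi)^-1)%:E *
   \int[lebesgue_measure]_(t in `[0%R, (2 * pi)%R]) u (circle_point a r t))%E.

(* The constant -oo is allowed. *)
Definition subharmonic (V : set R[i]) (u : R[i] -> \bar R) : Prop :=
  usc_on V u /\
  forall (a : R[i]) (r : R), 0 < r ->
    (forall z : R[i], `|z - a| <= r%:C -> V z) ->
    (u a <= circle_mean u a r)%E.

Context {n : nat}.
Implicit Types (X U : set 'rV[R[i]]_n) (u : 'rV[R[i]]_n -> \bar R).

Definition plurisubharmonic U u : Prop :=
  usc_on U u /\
  forall a b : 'rV[R[i]]_n,
    subharmonic [set z : R[i] | U (a + z *: b)] (fun z : R[i] => u (a + z *: b)).

Definition PSHo X u : Prop :=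
  exists U (u' : 'rV[R[i]]_n -> \bar R),
    [/\ open U, X `<=` U, plurisubharmonic U u', cont_on U u'
      & forall z, X z -> u' z = u z].

End Plurisubharmonic.

Section Jensen.
Context {R : realType} {n : nat}.

Definition borelC : Type := g_sigma_algebraType (@open 'rV[R[i]]_n).
HB.instance Definition _ := Measurable.on borelC.

Definition regular_measure (mu : set borelC -> \bar R) : Prop :=
  forall A : set borelC, measurable A ->
    mu A = ereal_inf [set mu U | U in
             [set U : set 'rV[R[i]]_n | open U /\ A `<=` U]] /\
    mu A = ereal_sup [set mu K | K in
             [set K : set 'rV[R[i]]_n | compact K /\ K `<=` A]].

(* A Borel probability measure on the compact set X is encoded as a Borel
   probability measure on C^n that gives X full mass. *)
Definition jensen_measure (X : set 'rV[R[i]]_n) (z : 'rV[R[i]]_n)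
    (mu : probability borelC R) : Prop :=
  [/\ mu X = 1%E, regular_measure mu
    & forall u, PSHo X u -> (u z <= \int[mu]_(x in X) u x)%E].

Definition PSH (X : set 'rV[R[i]]_n) (u : 'rV[R[i]]_n -> \bar R) : Prop :=
  usc_on X u /\
  forall z (mu : probability borelC R), X z -> jensen_measure X z mu ->
    (u z <= \int[mu]_(x in X) u x)%E.

Definition bounded_domain (Omega : set 'rV[R[i]]_n) : Prop :=
  [/\ open Omega, connected Omega, Omega !=set0 & bounded_set Omega].

Definition P_hyperconvex (Omega : set 'rV[R[i]]_n) : Prop :=
  bounded_domain Omega /\
  exists phi : 'rV[R[i]]_n -> \bar R,
    [/\ PSH (closure Omega) phi,
        cont_on (closure Omega) phi,
        exists x y, [/\ closure Omega x, closure Omega y & phi x <> phi y]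
      & forall z, boundary Omega z -> phi z = 0%E].

Definition dirichlet_solution (Omega : set 'rV[R[i]]_n)
    (f v : 'rV[R[i]]_n -> \bar R) : Prop :=
  PSH (closure Omega) v /\ forall z, boundary Omega z -> v z = f z.

End Jensen.

(* Main.v *)
Require Import Defs.
From HB Require Import structures.
From mathcomp Require Import all_boot all_order all_algebra.
From mathcomp Require Import all_classical all_reals all_analysis.
From mathcomp Require Import measurable_realfun.
From mathcomp Require Import complex.
From mathcomp Require Import ring lra.

(** The theorem rests on one fact: for a boundary point [z], the Jensen measures
    of [z] on the closure [K] and on the boundary [bd] of [Omega] are the same.
    One inclusion is immediate, since functions plurisubharmonic near [K] are
    plurisubharmonic near [bd] ([jensen_extend]).  It shows that restricting a
    solution to the boundary gives a function of [PSH bd].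

    For the other inclusion let [phi] be the exhaustion function.  By the maximum
    principle [phi] is negative in [Omega], so the Jensen inequality
    [0 = phi z <= \int phi] forces a Jensen measure of [z] on [K] to live on [bd]
    ([jensen_boundary]).  It must then be tested against a function [u] that is
    continuous and plurisubharmonic near [bd] only.  Adding to [u] a large
    multiple of [phi] leaves the boundary values alone and makes the sum very
    negative a little inside, so that the maximum of the sum with a constant
    extends to all of [K] ([extend_from_boundary], [jensen_restrict]).

    Consequently any [f] of [PSH bd] has a solution: [f] on the boundary and [-oo]
    inside ([PSH_boundary_extension]).  When [f] is continuous, it is a uniform
    limit from below of functions plurisubharmonic near [bd], hence of boundary
    values of functions plurisubharmonic near [K].  Those are combined into an
    increasing sequence by taking maxima, each new function being first pushed
    down inside [Omega] by a multiple of [phi], so that the increments are small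
    on all of [K]; the limit is a continuous solution
    ([continuous_boundary_extension]).

    All this uses that [phi] and [f], which only satisfy inequalities against
    Jensen measures, are uniform limits of functions plurisubharmonic near the
    compact set ([PSH_approx]).  This is Edwards' theorem ([edwards]): the
    Hahn-Banach theorem produces a positive functional attaining the upper
    envelope of the cone at a point, and the Riesz theorem turns it into a Jensen
    measure.  The glueing also uses that plurisubharmonicity is a local property
    ([psh_on_local]). *)

Set Implicit Arguments.
Unset Strict Implicit.
Unset Printing Implicit Defensive.

Import Order.TTheory GRing.Theory Num.Theory.
Import numFieldNormedType.Exports.

Local Open Scope classical_set_scope.
Local Open Scope ring_scope.
Local Open Scope complex_scope.

(** * The Hahn-Banach theorem *)

Section HahnBanach.
Context {R : realType} {V : lmodType R}.
Variable B : set V.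
Hypotheses (B0 : B 0) (BD : forall x y, B x -> B y -> B (x + y))
  (BZ : forall t x, B x -> B (t *: x)).

Definition sublinear (q : V -> R) : Prop :=
  (forall x y, B x -> B y -> q (x + y) <= q x + q y) /\
  (forall t x, 0 < t -> B x -> q (t *: x) <= t * q x).

Lemma subspaceN x : B x -> B (- x).
Proof. by move=> Bx; rewrite -scaleN1r; exact: BZ. Qed.

Lemma sublinearZ q t x : sublinear q -> 0 < t -> B x -> q (t *: x) = t * q x.
Proof.
move=> [_ qZ] t0 Bx; apply/eqP; rewrite eq_le qZ//=.
have := qZ t^-1 (t *: x); rewrite invr_gt0 => /(_ t0 (BZ t Bx)).
by rewrite scalerA mulVf ?gt_eqF// scale1r -(ler_pM2l t0) mulrA divff ?gt_eqF// mul1r.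
Qed.

Lemma sublinear0 q : sublinear q -> q 0 = 0.
Proof.
move=> qs; have := @sublinearZ q 2%:R 0 qs ltac:(by rewrite ltr0n) B0.
by rewrite scaler0 => h; lra.
Qed.

Lemma sublinear_geN q x : sublinear q -> B x -> - q (- x) <= q x.
Proof.
move=> qs Bx; have := qs.1 x (- x) Bx (subspaceN Bx).
by rewrite subrr (sublinear0 qs) => h; lra.
Qed.

(** The largest sublinear functional below [q] taking the value [- q y] at
    [- y], in other words linear on the line of [y]. *)
Definition slide (q : V -> R) (y x : V) : R :=
  inf [set s | exists2 t, 0 <= t & s = q (x + t *: y) - t * q y].

Lemma slide_lb q y x : sublinear q -> B x -> B y ->
  lbound [set s | exists2 t, 0 <= t & s = q (x + t *: y) - t * q y] (- q (- x)).
Proof.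
move=> qs Bx By _ [t t0 ->].
have [->|tn0] := eqVneq t 0.
  by rewrite scale0r addr0 mul0r subr0 sublinear_geN.
have t1 : 0 < t by rewrite lt_neqAle eq_sym tn0.
have := qs.1 (x + t *: y) (- x) (BD Bx (BZ t By)) (subspaceN Bx).
by rewrite addrAC subrr add0r sublinearZ// => h; lra.
Qed.

Lemma slide_le q y x t : sublinear q -> B x -> B y -> 0 <= t ->
  slide q y x <= q (x + t *: y) - t * q y.
Proof.
move=> qs Bx By t0; apply: ge_inf; last by exists t.
by exists (- q (- x)); exact: slide_lb.
Qed.

Lemma slide_approx q y x e : sublinear q -> B x -> B y -> 0 < e ->
  exists2 t, 0 <= t & q (x + t *: y) - t * q y < slide q y x + e.
Proof.
move=> qs Bx By e0.
have hi : has_inf [set s | exists2 t, 0 <= t & s = q (x + t *: y) - t * q y].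
  split; first by exists (q (x + 0 *: y) - 0 * q y), 0.
  by exists (- q (- x)); exact: slide_lb.
by have [_ [t t0 ->] lte] := inf_adherent e0 hi; exists t.
Qed.

Lemma slide_sublinear q y : sublinear q -> B y -> sublinear (slide q y).
Proof.
move=> qs By; split=> [x1 x2 Bx1 Bx2|s x s0 Bx].
  apply/ler_addgt0Pr => e e0.
  have e2 : 0 < e / 2 by rewrite divr_gt0.
  have [t1 t10 h1] := slide_approx qs Bx1 By e2.
  have [t2 t20 h2] := slide_approx qs Bx2 By e2.
  have := slide_le qs (BD Bx1 Bx2) By (addr_ge0 t10 t20).
  rewrite scalerDl addrACA.
  have := qs.1 _ _ (BD Bx1 (BZ t1 By)) (BD Bx2 (BZ t2 By)).
  by move: h1 h2; lra.
apply/ler_addgt0Pr => e e0.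
have [t t0 h] := slide_approx qs Bx By (divr_gt0 e0 s0).
have := slide_le qs (BZ s Bx) By (mulr_ge0 (ltW s0) t0).
rewrite -scalerA -scalerDr (sublinearZ qs s0 (BD Bx (BZ t By))).
move: h; rewrite -(ltr_pM2l s0) !mulrDr (mulrC s (e / s)) divfK ?gt_eqF// => h1 h2.
rewrite (le_trans h2)// ltW// (le_lt_trans _ h1)//.
by rewrite mulrN mulrA.
Qed.

Lemma slide_ub q y x : sublinear q -> B x -> B y -> slide q y x <= q x.
Proof.
move=> qs Bx By; have := slide_le qs Bx By (lexx 0).
by rewrite scale0r addr0 mul0r subr0.
Qed.

(** The functionals vanish off [B] so that their pointwise order on [B] is
    antisymmetric, as Zorn's lemma requires. *)
Let below (p q : V -> R) : Prop :=
  [/\ sublinear q, forall x, B x -> q x <= p x & forall x, ~ B x -> q x = 0].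

(** Zorn's lemma: the infimum of a chain below [p] is finite because each member
    is at least [- p (- x)] at [x]. *)
Lemma minimal_sublinear p : sublinear p ->
  exists q, below p q /\
    forall r, sublinear r -> (forall x, B x -> r x <= q x) ->
      forall x, B x -> r x = q x.
Proof.
move=> ps; pose T := {q : V -> R | below p q}.
pose le (q r : T) : bool := `[< forall x, B x -> sval r x <= sval q x >].
have norm (r : V -> R) : sublinear r -> (forall x, B x -> r x <= p x) ->
    below p (fun x => if `[< B x >] then r x else 0).
  move=> [rD rZ] rp; split.
  - split=> [x y Bx By|t x t0 Bx]; rewrite !asboolT//.
    + exact: rD.
    + exact: BD.
    + exact: rZ.
    + exact: BZ.
  - by move=> x Bx; rewrite asboolT//; exact: rp.
  - by move=> x Bx; rewrite asboolF.
have [||||q qmin] := @Zorn T le.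
- by move=> t; apply/asboolP => x _.
- move=> r s t /asboolP rs /asboolP st; apply/asboolP => x Bx.
  by rewrite (le_trans (st x Bx))// rs.
- move=> [s [s1 s2 s3]] [t [t1 t2 t3]] /asboolP/= st /asboolP/= ts.
  apply: eq_exist => /=; apply/funext => x; have [Bx|Bx] := pselect (B x).
    by apply/eqP; rewrite eq_le st// ts.
  by rewrite s3// t3.
- move=> A tA; have [[a0 Aa0]|A0] := pselect (A !=set0); last first.
    exists (exist _ _ (norm p ps (fun x _ => lexx (p x)))) => s As.
    by exfalso; apply: A0; exists s.
  pose m x := inf [set s | exists2 q : T, A q & s = sval q x].
  have mlb x : B x -> lbound [set s | exists2 q : T, A q & s = sval q x] (- p (- x)).
    move=> Bx _ [[q [q1 q2 q3]] _ ->] /=.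
    rewrite (le_trans _ (sublinear_geN q1 Bx))// lerN2 q2//.
    exact: subspaceN.
  have mle x q : B x -> A q -> m x <= sval q x.
    move=> Bx Aq; apply: ge_inf; last by exists q.
    by exists (- p (- x)); exact: mlb.
  have mapp x e : B x -> 0 < e -> exists2 q : T, A q & sval q x < m x + e.
    move=> Bx e0.
    have hi : has_inf [set s | exists2 q : T, A q & s = sval q x].
      by split; [exists (sval a0 x), a0|exists (- p (- x)); exact: mlb].
    by have [_ [q Aq ->] lte] := inf_adherent e0 hi; exists q.
  have ms : sublinear m.
    split=> [x y Bx By|t x t0 Bx].
      apply/ler_addgt0Pr => e e0; have e2 : 0 < e / 2 by rewrite divr_gt0.
      have [q1 Aq1 h1] := mapp x _ Bx e2.
      have [q2 Aq2 h2] := mapp y _ By e2.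
      wlog q12 : x y Bx By q1 q2 Aq1 Aq2 h1 h2 / le q1 q2.
        move=> H; have [q12|q21] := tA _ _ Aq1 Aq2; first exact: (H x y Bx By q1 q2).
        rewrite addrC (addrC (m x)); exact: (H y x By Bx q2 q1).
      have := mle _ _ (BD Bx By) Aq2.
      have := (svalP q2).
      move=> [[+ _] _ _] => /(_ x y Bx By).
      have := asboolW q12 x Bx.
      by move: h1 h2; lra.
    apply/ler_addgt0Pr => e e0.
    have [q Aq h] := mapp x _ Bx (divr_gt0 e0 t0).
    rewrite (le_trans (mle _ _ (BZ t Bx) Aq))//.
    have [[_ qZ] _ _] := svalP q; rewrite (le_trans (qZ _ _ t0 Bx))//.
    by rewrite -ler_pdivlMl// mulrDr mulrA mulVf ?gt_eqF// mul1r mulrC ltW.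
  have mp x : B x -> m x <= p x.
    move=> Bx; rewrite (le_trans (mle x _ Bx Aa0))//.
    by have [_ + _] := svalP a0; apply.
  exists (exist _ _ (norm m ms mp)) => s As; apply/asboolP => x Bx /=.
  by rewrite asboolT//; exact: mle.
exists (sval q); split; first exact: svalP.
have [q1 q2 q3] := svalP q.
move=> r rs rq x Bx.
have rp y : B y -> r y <= p y by move=> By; rewrite (le_trans (rq y By))// q2.
have /qmin/(congr1 (fun s : T => sval s x))/= : le q (exist _ _ (norm r rs rp)).
  by apply/asboolP => y By /=; rewrite asboolT//; exact: rq.
by rewrite asboolT.
Qed.

(** A minimal sublinear functional cannot be lowered by sliding, hence is
    additive.  Starting from the slide of [p] along [x0] forces equality at
    [x0]. *)
Theorem hahn_banach (p : V -> R) (x0 : V) : sublinear p -> B x0 ->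
  exists L : V -> R,
    [/\ forall x y, B x -> B y -> L (x + y) = L x + L y,
        forall t x, B x -> L (t *: x) = t * L x,
        forall x, B x -> L x <= p x & L x0 = p x0].
Proof.
move=> ps Bx0.
have [L [[Ls Lp _] Lmin]] := minimal_sublinear (slide_sublinear ps Bx0).
have LD x y : B x -> B y -> L (x + y) = L x + L y.
  move=> Bx By; apply/eqP; rewrite eq_le Ls.1//=.
  have <- : slide L y x = L x.
    by apply: Lmin => //; [exact: slide_sublinear|move=> z Bz; exact: slide_ub].
  by have := slide_le Ls Bx By ler01; rewrite scale1r mul1r; lra.
have LN x : B x -> L (- x) = - L x.
  move=> Bx; have := LD x (- x) Bx (subspaceN Bx).
  by rewrite subrr (sublinear0 Ls); lra.
exists L; split=> //.
- move=> t x Bx; have [t0|t0|->] := ltgtP t 0; last 1 first.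
  + by rewrite scale0r mul0r (sublinear0 Ls).
  + have := @sublinearZ L (- t) x Ls ltac:(by rewrite oppr_gt0) Bx.
    by rewrite scaleNr LN ?mulNr; [move/oppr_inj|exact: BZ].
  + exact: sublinearZ.
- by move=> x Bx; rewrite (le_trans (Lp x Bx))// slide_ub.
- apply/eqP; rewrite eq_le (le_trans (Lp _ Bx0)) ?slide_ub//=.
  have := slide_le ps (subspaceN Bx0) Bx0 ler01.
  rewrite scale1r addNr mul1r (sublinear0 ps) sub0r.
  by move/(le_trans (Lp _ (subspaceN Bx0))); rewrite LN// lerN2.
Qed.

End HahnBanach.

(** * Borel probability measures *)

Section CaratheodoryBorel.
Context {R : realType} {T : ptopologicalType}.
Notation borel := (g_sigma_algebraType (@open T)).

(** The Caratheodory measurable sets form a sigma-algebra on which the outer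
    measure is a measure; it contains the Borel sets as soon as it contains the
    open sets. *)
Lemma borel_probability_of_outer_measure
    (mu : {outer_measure set T -> \bar R}) :
  mu setT = 1%E -> (forall U : set T, open U -> mu.-caratheodory U) ->
  exists P : probability borel R, forall A, P A = mu A.
Proof.
move=> mu1 muo.
have sub (A : set borel) : measurable A -> mu.-caratheodory A.
  apply: (@smallest_sub _ (sigma_algebra setT) _ (mu.-caratheodory)) => //.
  split; first exact: caratheodory_measurable_set0.
  - by move=> B cB; rewrite setTD; exact: caratheodory_measurable_setC.
  - by move=> F cF; exact: caratheodory_measurable_bigcup.
pose P (A : set borel) := mu A.
have P0 : P set0 = 0%E by exact: outer_measure0.
have Pge0 A : (0 <= P A)%E by exact: outer_measure_ge0.
have Psa : semi_sigma_additive P.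
  move=> F mF tF mcF; apply: caratheodory_measure_sigma_additive => //.
  - by move=> i; exact: sub.
  - exact: sub.
pose Pm := isMeasure.Build _ borel R P P0 Pge0 Psa.
pose PM : {measure set borel -> \bar R} := HB.pack P Pm.
have PM1 : PM setT = 1%E by [].
pose PPm := Measure_isProbability.Build _ _ _ PM PM1.
pose PP : probability borel R := HB.pack (Measure.sort PM) PPm.
by exists PP.
Qed.
End CaratheodoryBorel.

(** * Continuous functions on a subset *)

Section Within.
Context {R : realType} {T : topologicalType}.
Variable X : set T.
Implicit Types f g : T -> R.
Definition cont_within f := {within X, continuous f}.

Lemma cont_within_cst c : cont_within (fun=> c).
Proof. exact: cst_continuous. Qed.
Lemma cont_withinD f g : cont_within f -> cont_within g -> cont_within (f \+ g).
Proof. by move=> cf cg x; apply: continuousD; [exact: cf|exact: cg]. Qed.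
Lemma cont_withinZ c f : cont_within f -> cont_within (fun x => c * f x).
Proof. by move=> cf x; apply: continuousM; [exact: cst_continuous|exact: cf]. Qed.
Lemma cont_withinN f : cont_within f -> cont_within (\- f).
Proof. by move=> cf x; apply: continuousN; exact: cf. Qed.
Lemma cont_within_max f g : cont_within f -> cont_within g ->
  cont_within (fun x => Num.max (f x) (g x)).
Proof. by move=> cf cg x; apply: continuous_max; [exact: cf|exact: cg]. Qed.
Lemma cont_within_min f g : cont_within f -> cont_within g ->
  cont_within (fun x => Num.min (f x) (g x)).
Proof. by move=> cf cg x; apply: continuous_min; [exact: cf|exact: cg]. Qed.
Lemma cont_withinW f : continuous f -> cont_within f.
Proof. exact: continuous_subspaceT. Qed.

Lemma cont_within_eq f g : (forall x, X x -> f x = g x) -> cont_within f -> cont_within g.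
Proof.
move=> fg; apply: (@subspace_eq_continuous T X R f g).
by move=> x; rewrite inE; exact: fg.
Qed.

Lemma cont_within_closed_ge f c : closed X -> cont_within f -> closed [set x | X x /\ c <= f x].
Proof.
move=> clX cf.
have /closed_subspaceP[W clW WE] : closed (f @^-1` [set y | c <= y] : set (subspace X)).
  by move/continuous_closedP: cf; apply; exact: closed_ge.
rewrite (_ : [set x | _] = W `&` X); last first.
  by rewrite WE; apply/seteqP; split=> x [].
exact: closedI.
Qed.

Lemma cont_within_bounded f : compact X -> cont_within f ->
  exists M, forall x, X x -> `|f x| <= M.
Proof.
move=> cX cf; have [X0|] := pselect (X !=set0); last first.
  by move=> X0; exists 0 => x Xx; exfalso; apply: X0; exists x.
have cnf : {within X, continuous (fun x => `|f x|)}.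
  by move=> x; apply: continuous_comp; [exact: cf|exact: norm_continuous].
have [c _ fc] := compact_EVT_max X0 cX cnf; exists `|f c| => x Xx.
by apply: fc; rewrite inE.
Qed.
End Within.

Lemma cont_within_open (R : realType) (T : topologicalType) (X U : set T)
    (g : T -> R) : open U -> U `<=` X -> cont_within X g ->
  forall x, U x -> {for x, continuous g}.
Proof.
move=> oU UX cg x Ux; have : {within U, continuous g}.
  exact: (continuous_subspaceW UX).
by rewrite continuous_open_subspace// => /(_ x); rewrite inE; apply.
Qed.

Lemma closure_sub_closed (T : topologicalType) (A B : set T) :
  closed B -> A `<=` B -> closure A `<=` B.
Proof. by move=> clB AB; rewrite [X in _ `<=` X](closure_id B).1//; exact: closure_subset. Qed.

Arguments cont_within_cst {R T} X c.
Arguments cont_withinZ {R T X} c {f}.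

Section Functional.
Context {R : realType} {T : topologicalType} (X : set T).

Lemma cont_within_sum (I : Type) (s : seq I) (F : I -> T -> R) :
  (forall i, cont_within X (F i)) -> cont_within X (fun x => \sum_(i <- s) F i x).
Proof.
move=> cF; elim: s => [|i s IH].
  by under eq_fun do rewrite big_nil; exact: cont_within_cst.
by under eq_fun do rewrite big_cons; exact: cont_withinD.
Qed.

Lemma functional_sum (L : (T -> R) -> R) (I : Type) (s : seq I) (F : I -> T -> R) :
  (forall f g, cont_within X f -> cont_within X g -> L (f \+ g) = L f + L g) -> L (fun=> 0) = 0 ->
  (forall i, cont_within X (F i)) ->
  L (fun x => \sum_(i <- s) F i x) = \sum_(i <- s) L (F i).
Proof.
move=> LD L0 cF; elim: s => [|i s IH].
  by under eq_fun do rewrite big_nil; rewrite big_nil.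
under eq_fun do rewrite big_cons; rewrite big_cons -IH -LD//.
exact: cont_within_sum.
Qed.
End Functional.
Arguments cont_within_sum {R T X I} s {F}.

Definition borel_regular (R : realType) (T : ptopologicalType)
    (mu : set (g_sigma_algebraType (@open T)) -> \bar R) : Prop :=
  forall A, measurable A ->
    mu A = ereal_inf [set mu U | U in [set U : set T | open U /\ A `<=` U]] /\
    mu A = ereal_sup [set mu K | K in [set K : set T | compact K /\ K `<=` A]].

Section BorelMeasure.
Context {R : realType} {T : ptopologicalType}.
Notation borel := (g_sigma_algebraType (@open T)).
Variable X : set T.
Hypotheses (cX : compact X) (clX : closed X).
Notation CX := (@cont_within R T X).

Lemma cont_within_measurable f : CX f -> measurable_fun (X : set borel) (f : borel -> R).
Proof.
move=> cf mX; apply: (measurability _ (measurable_realfun.RGenCInfty.measurableE R)) => //.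
move=> _ [_ [c ->] <-].
have -> : X `&` f @^-1` `[c, +oo[%classic = ~` (~` [set x | X x /\ c <= f x]).
  by rewrite setCK; apply/seteqP; split=> x /=; rewrite in_itv/= andbT.
apply: measurableC; apply: sub_sigma_algebra.
by apply: closed_openC; exact: cont_within_closed_ge.
Qed.

Lemma borel_closed : measurable (X : set borel).
Proof.
rewrite -[X]setCK; apply: measurableC; apply: sub_sigma_algebra.
exact: closed_openC.
Qed.

Lemma cont_within_integrable (mu : probability borel R) f : CX f ->
  mu.-integrable (X : set borel) (EFin \o f).
Proof.
move=> cf; have [M fM] := cont_within_bounded cX cf.
apply: measurable_bounded_integrable => //.
- exact: borel_closed.
- by rewrite (le_lt_trans (probability_le1 mu borel_closed)) ?ltry.
- exact: cont_within_measurable.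
- exists M; split; first exact: num_real.
  by move=> c Mc x Xx /=; rewrite (le_trans (fM x Xx))// ltW.
Qed.

End BorelMeasure.

(** * The Riesz representation theorem *)

Section Riesz.
Context {R : realType} {T : ptopologicalType}.
Notation borel := (g_sigma_algebraType (@open T)).
Hypothesis cozero : forall U : set T, open U -> exists d : T -> R,
  continuous d /\ forall x, 0 <= d x /\ (0 < d x <-> U x).
Variable X : set T.
Hypotheses (cX : compact X) (clX : closed X).
Notation CX := (@cont_within R T X).
Variable L : (T -> R) -> R.
Hypotheses (LD : forall f g, CX f -> CX g -> L (f \+ g) = L f + L g)
  (LZ : forall c f, CX f -> L (fun x => c * f x) = c * L f)
  (Lmono : forall f g, CX f -> CX g -> (forall x, X x -> f x <= g x) -> L f <= L g)
  (L1 : L (fun=> 1) = 1).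

Let L_cst c : L (fun=> c) = c.
Proof.
by have := LZ c (cont_within_cst X 1); rewrite L1 mulr1.
Qed.

Let L_sum (I : Type) (s : seq I) (F : I -> T -> R) : (forall i, CX (F i)) ->
  L (fun x => \sum_(i <- s) F i x) = \sum_(i <- s) L (F i).
Proof. by apply: functional_sum => //; exact: L_cst. Qed.

Definition test_function (U : set T) (f : T -> R) : Prop :=
  CX f /\ forall x, X x -> [/\ 0 <= f x, f x <= 1 & ~ U x -> f x <= 0].

(** The measure that a regular measure representing [L] must give to the open
    set [U]. *)
Definition open_content (U : set T) : R := sup [set L f | f in test_function U].

Let L_le1 U f : test_function U f -> L f <= 1.
Proof.
by move=> [cf h]; rewrite -L1; apply: Lmono => //; [exact: cont_within_cst|move=> x /h[]].
Qed.

Let test_function0 U : test_function U (fun=> 0).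
Proof. by split; [exact: cont_within_cst|]. Qed.

Let open_content_has_sup U : has_sup [set L f | f in test_function U].
Proof.
split; first by exists (L (fun=> 0)), (fun=> 0).
by exists 1 => _ [f tf <-]; exact: L_le1 tf.
Qed.

Let open_content_ub U f : test_function U f -> L f <= open_content U.
Proof. by move=> tf; apply: sup_upper_bound; [exact: open_content_has_sup|exists f]. Qed.

Let open_content_approx U e : 0 < e -> exists2 f, test_function U f & open_content U < L f + e.
Proof.
move=> e0; have [_ [f tf <-] h] := sup_adherent e0 (open_content_has_sup U).
by exists f => //; rewrite -ltrBlDr.
Qed.

Let open_content_le U c : (forall f, test_function U f -> L f <= c) -> open_content U <= c.
Proof.
move=> h; apply: ge_sup; first by have [] := open_content_has_sup U.
by move=> _ [f tf <-]; exact: h.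
Qed.

Let open_content_mono U V : U `<=` V -> open_content U <= open_content V.
Proof.
move=> UV; apply: open_content_le => f [cf tf]; apply: open_content_ub; split => //.
by move=> x /tf[f0 f1 fU]; split=> // nV; apply: fU => /UV.
Qed.

Let open_content_ge0 U : 0 <= open_content U.
Proof. by rewrite -(L_cst 0); exact: open_content_ub. Qed.

Let open_content_setT : open_content setT = 1.
Proof.
apply/eqP; rewrite eq_le open_content_le; last by move=> f; exact: L_le1.
rewrite -[leLHS]L1 open_content_ub//; split; first exact: cont_within_cst.
by move=> x _; split => // /(_ I).
Qed.

Let open_content_off : open_content (~` X) = 0.
Proof.
apply/eqP; rewrite eq_le open_content_ge0 andbT; apply: open_content_le => f [cf tf].
rewrite -(L_cst 0); apply: Lmono => //; first exact: cont_within_cst.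
by move=> x Xx; have [_ _] := tf x Xx; apply => /(_ Xx).
Qed.

(** A test function [f] of the union is bounded, up to an error, by a finite sum
    of test functions of the [U i]: the compact set where [f] is not small is
    covered by finitely many of the sets where the functions [d i] exceed a common
    threshold. *)
Let open_content_sub (U : nat -> set T) : (forall i, open (U i)) ->
  ((open_content (\bigcup_i U i))%:E <= \sum_(i <oo) (open_content (U i))%:E)%E.
Proof.
move=> oU; have {}/choice[d dP] := fun i => cozero (oU i).
have cd i : continuous (d i) by have [] := dP i.
have d0 i x : 0 <= d i x by have [_ /(_ x)[]] := dP i.
have dU i x : 0 < d i x <-> U i x by have [_ /(_ x)[]] := dP i.
apply/lee_addgt0Pr => e e0.
suff [N hN] : exists N, open_content (\bigcup_i U i) <= \sum_(i < N) open_content (U i) + e.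
  have : ((\sum_(i < N) open_content (U i) + e)%:E <=
      \sum_(i <oo) (open_content (U i))%:E + e%:E)%E.
    rewrite EFinD leeD2r// -sumEFin -(big_mkord xpredT (fun i => (open_content (U i))%:E)).
    by apply: nneseries_lim_ge => i _; rewrite lee_fin.
  by apply: le_trans; rewrite lee_fin.
have e2 : 0 < e / 2 by rewrite divr_gt0.
have [f [cf tf] fe] := open_content_approx (\bigcup_i U i) e2.
pose K := [set x | X x /\ e / 2 <= f x].
have clK : closed K by exact: cont_within_closed_ge.
have cK : compact K by apply: (subclosed_compact clK cX) => x [].
pose O n := \bigcup_(i in [set i | (i < n)%N]) [set x | n.+1%:R^-1 < d i x].
have oO n : open (O n).
  apply: bigcup_open => i _.
  by move/continuousP: (cd i) => /(_ _ (@open_gt R n.+1%:R^-1)).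
have Omono n m : (n <= m)%N -> O n `<=` O m.
  move=> nm x [i /= iN dx]; exists i => /=; first exact: leq_trans nm.
  by apply: le_lt_trans dx; rewrite lef_pV2 ?posrE ?ltr0n// ler_nat ltnS.
have KO : K `<=` \bigcup_n O n.
  move=> x [Xx fx]; have [_ _ fU] := tf x Xx.
  have [[i _ /dU dx]|nU] := pselect ((\bigcup_i U i) x); last first.
    by have := lt_le_trans e2 (le_trans fx (fU nU)); rewrite ltxx.
  have [n hn] : exists n : nat, (d i x)^-1 < n.+1%:R.
    exists (Num.bound (d i x)^-1); rewrite (@lt_trans _ _ (Num.bound (d i x)^-1)%:R)//.
      by rewrite archi_boundP// invr_ge0.
    by rewrite ltr_nat.
  exists (maxn i.+1 n) => //; exists i => /=; first exact: leq_maxl.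
  rewrite -[ltRHS]invrK ltf_pV2 ?posrE ?invr_gt0// ?ltr0n//.
  by apply: lt_le_trans hn _; rewrite ler_nat ltnS leq_maxr.
have [N KN] : exists N, K `<=` O N.
  move: cK; rewrite compact_cover => /(_ nat setT O (fun n _ => oO n)).
  have KO' : K `<=` cover setT O by move=> x /KO[n _ ?]; exists n.
  move=> /(_ KO')[D _ KD]; exists (\max_(n <- finmap.enum_fset D) n)%N => x /KD[n /= nD Ox].
  by apply: Omono Ox; exact: (@leq_bigmax_seq _ _ xpredT id).
exists N; pose g (i : 'I_N) x := Num.min 1 (N.+1%:R * d i x).
have cg i : CX (g i).
  by apply: cont_within_min; [exact: cont_within_cst|apply: cont_withinZ; exact: cont_withinW].
have tg (i : 'I_N) : test_function (U i) (g i).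
  split => // x Xx; split.
  - by rewrite /g le_min ler01 mulr_ge0.
  - by rewrite /g ge_min lexx.
  - move=> nU; rewrite /g ge_min; apply/orP; right.
    by rewrite pmulr_rle0 ?ltr0n// leNgt; apply/negP => /dU.
have csum := cont_within_sum (index_enum 'I_N) cg.
have Lsum := L_sum (index_enum 'I_N) cg.
have : L f <= L (fun x => \sum_i g i x + e / 2).
  apply: Lmono => //; first by apply: cont_withinD => //; exact: cont_within_cst.
  move=> x Xx; have [fx0 fx1 _] := tf x Xx.
  have g0 : 0 <= \sum_i g i x by apply: sumr_ge0 => i _; have [_ /(_ x Xx)[]] := tg i.
  have [fxe|fxe] := lerP (e / 2) (f x); last first.
    by rewrite (le_trans (ltW fxe))// lerDr.
  have [i /= iN dx] : O N x by apply: KN.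
  apply: (le_trans fx1); apply: (@le_trans _ _ (\sum_i g i x)); last by rewrite lerDl ltW.
  rewrite (bigD1 (Ordinal iN))//= {1}/g /= min_l; last first.
    by rewrite -ler_pdivrMl ?ltr0n// mulr1 ltW.
  rewrite lerDl; apply: sumr_ge0 => j _; by have [_ /(_ x Xx)[]] := tg j.
rewrite (_ : (fun x => _) = (fun x => \sum_i g i x) \+ (fun=> e / 2))//.
rewrite LD ?L_cst//; last exact: cont_within_cst.
rewrite Lsum => h.
have : \sum_i L (g i) <= \sum_(i < N) open_content (U i).
  by apply: ler_sum => i _; exact: open_content_ub.
by move: h fe; lra.
Qed.

Definition outer_content (A : set T) : R :=
  inf [set open_content U | U in [set U | open U /\ A `<=` U]].

Let outer_has_inf A : has_inf [set open_content U | U in [set U | open U /\ A `<=` U]].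
Proof.
split; first by exists (open_content setT), setT => //; split => //; exact: openT.
by exists 0 => _ [U _ <-].
Qed.

Let outer_le A U : open U -> A `<=` U -> outer_content A <= open_content U.
Proof.
by move=> oU AU; apply: ge_inf; [have [] := outer_has_inf A|exists U].
Qed.

Let outer_approx A e : 0 < e ->
  exists U, [/\ open U, A `<=` U & open_content U < outer_content A + e].
Proof.
by move=> e0; have [_ [U [oU AU] <-] h] := inf_adherent e0 (outer_has_inf A); exists U.
Qed.

Let outer_ge A c : (forall U, open U -> A `<=` U -> c <= open_content U) -> c <= outer_content A.
Proof.
move=> h; apply: lb_le_inf; first by have [] := outer_has_inf A.
by move=> _ [U [oU AU] <-]; exact: h.
Qed.

Let outer_open U : open U -> outer_content U = open_content U.
Proof.
move=> oU; apply/eqP; rewrite eq_le outer_le//=.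
by apply: outer_ge => V _; exact: open_content_mono.
Qed.

Let outerE A : \bar R := (outer_content A)%:E.

Let outerE0 : outerE set0 = 0%E.
Proof.
rewrite /outerE outer_open; last exact: open0.
congr EFin; apply/eqP; rewrite eq_le open_content_ge0 andbT.
apply: open_content_le => f [cf tf]; rewrite -(L_cst 0); apply: Lmono => //.
  exact: cont_within_cst.
by move=> x /tf[_ _]; apply.
Qed.

Let outerE_ge0 A : (0 <= outerE A)%E.
Proof. by rewrite lee_fin; apply: outer_ge => U _ _; exact: open_content_ge0. Qed.

Let outerE_mono : {homo outerE : A B / A `<=` B >-> (A <= B)%E}.
Proof.
move=> A B AB; rewrite lee_fin; apply: outer_ge => U oU BU.
by apply: outer_le => //; exact: subset_trans BU.
Qed.

Let outerE_sub : sigma_subadditive outerE.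
Proof.
move=> F; apply/lee_addgt0Pr => e e0.
have : forall i, exists U, [/\ open U, F i `<=` U &
    open_content U < outer_content (F i) + e / (2 ^ i.+1)%:R].
  by move=> i; apply: outer_approx; rewrite divr_gt0// ltr0n expn_gt0.
move=> /choice[U Uh].
apply: le_trans (epsilon_trick xpredT (fun i => outerE_ge0 (F i)) (ltW e0)).
have oU i : open (U i) by have [] := Uh i.
apply: (@le_trans _ _ (open_content (\bigcup_i U i))%:E).
  rewrite lee_fin; apply: outer_le; first exact: bigcup_open.
  by move=> x [i _ Fx]; exists i => //; have [_ + _] := Uh i; apply.
apply: (le_trans (open_content_sub oU)); apply: lee_nneseries => i _.
  by rewrite lee_fin.
by have [_ _ /ltW] := Uh i; rewrite -EFinD lee_fin.
Qed.

Let outer_measure_pack := isOuterMeasure.Build R T outerE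
  outerE0 outerE_ge0 outerE_mono outerE_sub.
Let outerM : {outer_measure set T -> \bar R} := HB.pack outerE outer_measure_pack.

(** Take a test function [f] of [V `&` U] nearly realising its content, and a
    test function [h] of the part of [V] where [f] is small.  Their sum is then
    nearly a test function of [V]. *)
Let outer_caratheodory U : open U -> outerM.-caratheodory U.
Proof.
move=> oU; apply: le_caratheodory_measurable => A.
rewrite /= /outerE -EFinD lee_fin; apply: outer_ge => V oV AV.
apply/ler_addgt0Pr => e e0.
have e3 : 0 < e / 3 by rewrite divr_gt0.
have [f [cf tf] fe] := open_content_approx (V `&` U) e3.
pose K := [set x | X x /\ e / 3 <= f x].
have clK : closed K by exact: cont_within_closed_ge.
have oW : open (V `&` ~` K) by apply: openI => //; exact: closed_openC.
have h1 : outer_content (A `&` U) <= open_content (V `&` U).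
  by apply: outer_le; [exact: openI|exact: setSI].
have h2 : outer_content (A `&` ~` U) <= open_content (V `&` ~` K).
  apply: outer_le => // x [Ax nU]; split; first exact: AV.
  move=> [Xx fx]; have [_ _ fU] := tf x Xx.
  have : f x <= 0 by apply: fU => -[].
  by move: fx e3; lra.
have [h [ch th] he] := open_content_approx (V `&` ~` K) e3.
have cfe : CX (fun x => Num.max 0 (f x + - (e / 3))).
  apply: cont_within_max; first exact: cont_within_cst.
  by apply: cont_withinD => //; exact: cont_within_cst.
have : test_function V ((fun x => Num.max 0 (f x + - (e / 3))) \+ h).
  split; first exact: cont_withinD.
  move=> x Xx /=; have [f0 f1 fV] := tf x Xx; have [h0 h1' hV] := th x Xx.
  have [fxe|fxe] := lerP (e / 3) (f x).
    have h00 : h x <= 0 by apply: hV => -[_]; apply.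
    rewrite max_r ?subr_ge0//; split; [by lra|by lra|].
    by move=> nV; have : f x <= 0; [apply: fV => -[]|lra].
  rewrite max_l; last by rewrite subr_le0 ltW.
  split; [by lra|by lra|].
  by move=> nV; rewrite add0r; apply: hV => -[].
move/open_content_ub; rewrite LD//.
have : L f <= L ((fun x => Num.max 0 (f x + - (e / 3))) \+ (fun=> e / 3)).
  apply: Lmono => //; first by apply: cont_withinD => //; exact: cont_within_cst.
  by move=> x _ /=; rewrite -lerBlDr le_max lexx orbT.
rewrite LD//; last exact: cont_within_cst.
by rewrite L_cst; move: fe h1 h2 he; lra.
Qed.

Let mX : measurable (X : set borel) := borel_closed clX.

(** Slice [f] into [N.+1] layers of height [1 / N.+1].  The [i]-th layer is a
    multiple of a test function of the set [O i] where [f] exceeds its lower level,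
    while the same layer of [f + 1 / N.+1] dominates the indicator of [O i]. *)
Let L_layer (mu : probability borel R) f (N : nat) :
  (forall U : set T, open U -> mu U = (open_content U)%:E) ->
  CX f -> (forall x, X x -> 0 <= f x <= 1) ->
  L f <= Rintegral mu (X : set borel) f + N.+1%:R^-1.
Proof.
move=> muU cf f01; set e : R := N.+1%:R^-1.
have e0 : 0 < e by rewrite invr_gt0 ltr0n.
have mX0 : mu (~` (X : set borel)) = 0%E by rewrite muU ?open_content_off//; exact: closed_openC.
have muX : mu X = 1%E.
  rewrite -[X in mu X]setCK probability_setC; last exact: measurableC.
  by rewrite mX0 sube0.
(* the part of [u] between the levels [i%:R * e] and [i.+1%:R * e] *)
pose s (u : R) (i : nat) : R := Num.min u (i.+1%:R * e) - Num.min u (i%:R * e).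
have sum_s u : 0 <= u -> \sum_(i < N.+1) s u i = Num.min u 1.
  move=> u0; rewrite -(big_mkord xpredT (s u)).
  rewrite (@telescope_sumr_eq _ 0%N N.+1 (fun i => Num.min u (i%:R * e)))//.
  by rewrite mul0r (min_r u0) subr0 divff ?pnatr_eq0.
pose O i := ~` [set x | X x /\ f x <= i%:R * e].
have oO i : open (O i).
  apply: closed_openC.
  rewrite (_ : [set x | _] = [set x | X x /\ - (i%:R * e) <= - f x]).
    by apply: cont_within_closed_ge => //; exact: cont_withinN.
  by apply/seteqP; split=> x /=; rewrite lerN2.
have mO i : measurable (O i : set borel) by exact: sub_sigma_algebra.
have cs i : CX (fun x => s (f x) i).
  apply: cont_withinD; first by apply: cont_within_min => //; exact: cont_within_cst.
  by apply: cont_withinN; apply: cont_within_min => //; exact: cont_within_cst.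
have Ls i : L (fun x => s (f x) i) <= e * open_content (O i).
  rewrite -ler_pdivrMl// -LZ//; apply: open_content_ub; split; first exact: cont_withinZ.
  move=> x Xx; have /andP[f0 f1] := f01 x Xx.
  have ie : i.+1%:R * e = i%:R * e + e by rewrite -natr1 mulrDl mul1r.
  split.
  - apply: mulr_ge0; first by rewrite invr_ge0 ltW.
    by rewrite /s subr_ge0 ie le_min !ge_min lexx/= lerDl (ltW e0) orbT.
  - rewrite ler_pdivrMl// mulr1 /s lerBlDr ie ge_min.
    rewrite (minElt (f x)); case: ifP => _; first by rewrite lerDr (ltW e0).
    by rewrite addrC lexx orbT.
  - move=> nO; rewrite pmulr_rle0 ?invr_gt0// /s.
    have [_ fi] : X x /\ f x <= i%:R * e by apply: contrapT.
    by rewrite !min_l ?subrr// ie (le_trans fi)// lerDl ltW.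
have -> : L f = \sum_(i < N.+1) L (fun x => s (f x) i).
  have csum := cont_within_sum (index_enum 'I_N.+1) (fun i : 'I_N.+1 => cs i).
  rewrite -(L_sum (index_enum 'I_N.+1) (fun i : 'I_N.+1 => cs i)).
  by apply/eqP; rewrite eq_le; apply/andP; split; apply: Lmono => // x Xx;
  have /andP[f0 f1] := f01 x Xx; rewrite sum_s// min_l.
apply: (@le_trans _ _ (\sum_(i < N.+1) e * open_content (O i))).
  by apply: ler_sum => i _; exact: Ls.
have ce : CX (fun x => f x + e) by apply: cont_withinD => //; exact: cont_within_cst.
have cse i : CX (fun x => s (f x + e) i).
  apply: cont_withinD; first by apply: cont_within_min => //; exact: cont_within_cst.
  by apply: cont_withinN; apply: cont_within_min => //; exact: cont_within_cst.
have OI i : e * open_content (O i) <= Rintegral mu (X : set borel) (fun x => s (f x + e) i).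
  have mOX : mu (O i `&` X) = (open_content (O i))%:E.
    have : mu (O i `&` ~` (X : set borel)) = 0%E.
      apply/eqP; rewrite -measure_le0 -mX0; apply: le_measure => //.
      - by rewrite inE; apply: measurableI => //; exact: measurableC.
      - by rewrite inE; exact: measurableC.
    have E : mu (O i) = (mu (O i `&` ~` (X : set borel)) + mu (O i `&` X))%E.
      exact: (measureDI mu (mO i) mX).
    by move=> mO0; rewrite -(muU _ (oO i)) E mO0 add0e.
  have iO1 : mu.-integrable (X : set borel) (EFin \o \1_(O i)).
    apply: (@integrableS _ _ _ mu setT) => //.
    exact: integrable_indic.
  have iO : mu.-integrable (X : set borel) (EFin \o (fun x => e * \1_(O i) x)).
    exact: (integrableZl mX e iO1).
  rewrite (@le_trans _ _ (Rintegral mu (X : set borel) (fun x => e * \1_(O i) x)))//.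
    have -> : open_content (O i) = fine (mu (O i `&` X)) by rewrite mOX.
    rewrite RintegralZl// /Rintegral integral_indic//; exact: lexx.
  apply: le_Rintegral => //; first exact: (cont_within_integrable cX clX).
  move=> x Xx; rewrite indicE.
  have ie : i.+1%:R * e = i%:R * e + e by rewrite -natr1 mulrDl mul1r.
  rewrite /s ie; have [Ox|Ox] := boolP (x \in O i); last first.
    by rewrite mulr0 subr_ge0 le_min !ge_min lexx/= lerDl (ltW e0) orbT.
  have fi : i%:R * e < f x.
    rewrite ltNge; apply/negP => fi.
    by move: Ox; rewrite inE; apply.
  rewrite !min_r ?lerD2r ?(ltW fi)//; last by rewrite (le_trans (ltW fi))// lerDl ltW.
  by rewrite mulr1 addrAC subrr add0r.
apply: (@le_trans _ _ (\sum_(i < N.+1) Rintegral mu (X : set borel) (fun x => s (f x + e) i))).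
  by apply: ler_sum => i _; exact: OI.
pose I (h : T -> R) := Rintegral mu (X : set borel) h.
have ID h k : CX h -> CX k -> I (h \+ k) = I h + I k.
  by move=> ch ck; apply: RintegralD => //; exact: (cont_within_integrable cX clX).
have I0 : I (fun=> 0) = 0 by rewrite /I Rintegral_cst// mul0r.
rewrite -(functional_sum (index_enum 'I_N.+1) ID I0 (fun i : 'I_N.+1 => cse i)).
rewrite (@le_trans _ _ (I (fun x => f x + e)))//.
  apply: le_Rintegral => //; do ?exact: (cont_within_integrable cX clX).
    apply: (cont_within_integrable cX clX).
    exact: (cont_within_sum (index_enum 'I_N.+1) (fun i : 'I_N.+1 => cse i)).
  move=> x Xx; have /andP[f0 f1] := f01 x Xx.
  by rewrite sum_s ?ge_min ?lexx// addr_ge0// ltW.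
rewrite (ID f (fun=> e))//; last exact: cont_within_cst.
rewrite /I Rintegral_cst//.
have -> : fine (mu X) = 1 by rewrite muX.
by rewrite mulr1.
Qed.

(** The measure is the restriction to the Borel sets of the outer measure
    generated by [open_content]; this makes it outer regular by construction,
    hence inner regular by complementation in the compact set [X].  The layer
    estimate gives [L f <= \int f], and equality follows by applying it to [- f]. *)
Theorem riesz : exists mu : probability borel R,
  [/\ mu X = 1%E,
      borel_regular mu
    & forall f, CX f -> Rintegral mu (X : set borel) f = L f].
Proof.
have [|mu muE] := @borel_probability_of_outer_measure R T outerM _ outer_caratheodory.
  by rewrite /= /outerE outer_open ?open_content_setT//; exact: openT.
have {}muE (A : set T) : mu A = (outer_content A)%:E by exact: muE.
have muU (U : set T) : open U -> mu U = (open_content U)%:E.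
  by move=> oU; rewrite muE outer_open.
have mX0 : mu (~` (X : set borel)) = 0%E.
  by rewrite muU ?open_content_off//; exact: closed_openC.
have muX : mu X = 1%E.
  rewrite -[X in mu X]setCK probability_setC; last exact: measurableC.
  by rewrite mX0 sube0.
have le01 f : CX f -> (forall x, X x -> 0 <= f x <= 1) ->
    L f <= Rintegral mu (X : set borel) f.
  move=> cf f01; apply/ler_addgt0Pr => e e0.
  pose N := Num.bound e^-1.
  rewrite (le_trans (L_layer N muU cf f01))// lerD2l.
  rewrite invf_ple ?posrE ?ltr0n// (le_trans (ltW (archi_boundP _)))//.
    by rewrite invr_ge0 ltW.
  by rewrite ler_nat.
pose I (h : T -> R) := Rintegral mu (X : set borel) h.
have ID h k : CX h -> CX k -> I (h \+ k) = I h + I k.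
  by move=> ch ck; apply: RintegralD => //; exact: (cont_within_integrable cX clX).
have IZ c h : CX h -> I (fun x => c * h x) = c * I h.
  by move=> ch; apply: RintegralZl => //; exact: (cont_within_integrable cX clX).
have Icst c : I (fun=> c) = c.
  rewrite /I Rintegral_cst//.
  have -> : fine (mu X) = 1 by rewrite muX.
  by rewrite mulr1.
have leI f : CX f -> L f <= I f.
  move=> cf; have [M fM] := cont_within_bounded cX cf.
  pose c := (`|M| + 1) *+ 2; have c0 : 0 < c by rewrite pmulrn_lgt0// ltr_wpDl.
  have cg : CX (fun x => f x + (`|M| + 1)) by apply: cont_withinD => //; exact: cont_within_cst.
  have g01 x : X x -> 0 <= c^-1 * (f x + (`|M| + 1)) <= 1.
    move=> Xx; have := fM x Xx; rewrite ler_norml => /andP[h1 h2].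
    rewrite mulrC ler_pdivlMr// ler_pdivrMr// mul0r mul1r /c mulr2n.
    by move: h1 h2 (ler_norm M) => h1 h2 h3; apply/andP; split; lra.
  have : L (fun x => c^-1 * (f x + (`|M| + 1))) <= I (fun x => c^-1 * (f x + (`|M| + 1))).
    exact: (le01 _ (cont_withinZ _ cg) g01).
  rewrite IZ// LZ// ler_pM2l ?invr_gt0//.
  rewrite (ID f (fun=> _))//; last exact: cont_within_cst.
  rewrite (LD cf (cont_within_cst X (`|M| + 1))).
  by rewrite Icst L_cst lerD2r.
exists mu; split => //.
- have outer_reg (A : set T) :
      mu A = ereal_inf [set mu U | U in [set U : set T | open U /\ A `<=` U]].
    apply/eqP; rewrite eq_le; apply/andP; split.
      apply: le_ereal_inf_tmp => _ [U [oU AU] <-]; rewrite (muU _ oU) muE lee_fin.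
      exact: outer_le.
    apply/lee_addgt0Pr => e e0; have [U [oU AU Ue]] := outer_approx A e0.
    apply: (@le_trans _ _ (mu U)); first by apply: ereal_inf_lbound; exists U.
    by rewrite (muU _ oU) muE -EFinD lee_fin ltW.
  move=> A mA; split; first exact: outer_reg.
  apply/eqP; rewrite eq_le; apply/andP; split; last first.
    apply: ge_ereal_sup => _ [K [_ KA] <-].
    by rewrite !muE; exact: outerE_mono.
  apply/lee_addgt0Pr => e e0; have [U [oU AU Ue]] := outer_approx (~` A) e0.
  pose K := X `&` ~` U.
  have clU : closed (~` U) by exact: open_closedC.
  have cK : compact K by apply: (subclosed_compact _ cX); [exact: closedI|move=> x []].
  have KA : K `<=` A by move=> x [_ nU]; apply: contrapT => /AU.
  have mU : measurable (U : set borel) by exact: sub_sigma_algebra.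
  apply: (@le_trans _ _ (mu K + e%:E)%E); last first.
    by apply: leeD2r; apply: ereal_sup_ubound; exists K.
  have KE : mu K = (1 - mu U)%E.
    have E : mu (~` U) = (mu (~` U `&` ~` (X : set borel)) + mu (~` U `&` X))%E.
      by apply: (measureDI mu) => //; exact: measurableC.
    have Z : mu (~` U `&` ~` (X : set borel)) = 0%E.
      apply/eqP; rewrite eq_le measure_ge0 andbT -[leRHS]mX0 !muE.
      by apply: outerE_mono => x [].
    by rewrite /K setIC -[LHS]add0e -Z -E (probability_setC _ mU).
  have : mu (~` A) = (1 - mu A)%E by rewrite (probability_setC _ mA).
  rewrite KE (muU _ oU) !muE -EFinB -EFinB -EFinD lee_fin => -[].
  by move: Ue; lra.
- move=> f cf; apply/eqP; rewrite eq_le leI// andbT.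
  have : L (fun x => -1 * f x) <= I (fun x => -1 * f x) by exact: (leI _ (cont_withinZ (-1) cf)).
  by rewrite IZ// LZ// !mulN1r lerN2.
Qed.

End Riesz.

(** * Edwards' theorem *)

Section Edwards.
Context {R : realType} {T : ptopologicalType}.
Notation borel := (g_sigma_algebraType (@open T)).
Hypothesis cozero : forall U : set T, open U -> exists d : T -> R,
  continuous d /\ forall x, 0 <= d x /\ (0 < d x <-> U x).
Variable X : set T.
Hypotheses (cX : compact X) (clX : closed X).
Notation CX := (@cont_within R T X).
Variable S : set (T -> R).
Hypotheses (SC : forall u, S u -> CX u) (S_cst : forall c, S (fun=> c))
  (SD : forall u v, S u -> S v -> S (u \+ v))
  (SZ : forall c u, 0 < c -> S u -> S (fun x => c * u x))
  (S_max : forall u v, S u -> S v -> S (fun x => Num.max (u x) (v x))).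

Let cone_jensen (z : T) (mu : probability borel R) : Prop :=
  [/\ mu X = 1%E,
      borel_regular mu
    & forall u, S u -> u z <= Rintegral mu (X : set borel) u].

(** The functional [p f], minus the value at [z] of the upper envelope of the
    functions of [S] below [- f], is sublinear.  A linear functional dominated by
    [p] and equal to it at [- g] is positive because [S] contains [0], normalised
    because [S] contains the constants, and at least evaluation at [z] on [S].
    The measure representing it is thus a Jensen measure, and integrates [g] to
    the value at [z] of the envelope of [g]. *)
Lemma edwards_pointwise (g : T -> R) (z : T) (e : R) : CX g -> X z -> 0 < e ->
  (forall mu : probability borel R, cone_jensen z mu ->
    g z <= Rintegral mu (X : set borel) g) ->
  exists u, [/\ S u, forall x, X x -> u x <= g x & g z < u z + e].
Proof.
move=> cg Xz e0 gJ.
pose A f := [set - u z | u in [set u | S u /\ forall x, X x -> u x <= - f x]].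
pose p (f : T -> R) : R := inf (A f).
have hA f : CX f -> has_inf (A f).
  move=> cf; have [M fM] := cont_within_bounded cX cf; split.
    exists (- - M), (fun=> - M) => //; split => // x Xx.
    by rewrite lerN2 (le_trans (ler_norm _))// fM.
  by exists (f z) => _ [u [_ uf] <-]; rewrite lerNr uf.
have p_le f u : CX f -> S u -> (forall x, X x -> u x <= - f x) -> p f <= - u z.
  by move=> cf Su uf; apply: ge_inf; [have [] := hA f cf|exists u].
have p_app f d : CX f -> 0 < d ->
    exists u, [/\ S u, forall x, X x -> u x <= - f x & - u z < p f + d].
  by move=> cf d0; have [_ [u [Su uf] <-] ?] := inf_adherent d0 (hA f cf); exists u.
have ps : sublinear CX p.
  split=> [f h cf ch|t f t0 cf]; apply/ler_addgt0Pr => d d0.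
    have d2 : 0 < d / 2 by rewrite divr_gt0.
    have [u [Su uf ud]] := p_app f _ cf d2; have [v [Sv vf vd]] := p_app h _ ch d2.
    have : p (f + h) <= - (u z + v z).
      apply: (p_le _ (u \+ v)); [exact: cont_withinD|exact: SD|move=> x Xx /=].
      have := uf x Xx; have := vf x Xx; rewrite addrfctE; lra.
    by move: ud vd; lra.
  have [u [Su uf ud]] := p_app f _ cf (divr_gt0 d0 t0).
  have : p (t *: f) <= - (t * u z).
    apply: (p_le _ (fun x => t * u x)); [exact: cont_withinZ|exact: SZ|move=> x Xx].
    by rewrite scalrfctE -mulrN ler_pM2l// uf.
  move=> h; apply: (le_trans h); move: ud; rewrite -(ltr_pM2l t0) mulrN mulrDr.
  by rewrite mulrCA divff ?gt_eqF// mulr1 => /ltW.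
have B0 : CX 0 by exact: cont_within_cst.
have BD f h : CX f -> CX h -> CX (f + h) by exact: cont_withinD.
have BZ t f : CX f -> CX (t *: f) by exact: cont_withinZ.
have [L [LD LZ Lp Lg]] := hahn_banach B0 BD BZ ps (cont_withinN cg).
have Lmono f h : CX f -> CX h -> (forall x, X x -> f x <= h x) -> L f <= L h.
  move=> cf ch fh.
  have cd : CX (f + (-1) *: h) by apply: cont_withinD => //; exact: cont_withinZ.
  have : L (f + (-1) *: h) <= 0.
    rewrite (le_trans (Lp _ cd))//; rewrite -oppr0.
    apply: (p_le _ (fun=> 0)) => // x Xx.
    by rewrite addrfctE scalrfctE scaleN1r opprB subr_ge0 fh.
  by rewrite LD// ?LZ//; [lra|exact: cont_withinZ].
have c1 : CX (fun=> 1) := cont_within_cst X 1.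
have L1 : L (fun=> 1) = 1.
  apply/eqP; rewrite eq_le; apply/andP; split.
    rewrite (le_trans (Lp _ c1))// -[leRHS]opprK.
    exact: (p_le _ (fun=> - 1)).
  have : L ((-1) *: (fun=> 1)) <= - 1.
    have c1' : CX ((-1) *: (fun=> 1)) by exact: cont_withinZ.
    rewrite (le_trans (Lp _ c1'))//; apply: (p_le _ (fun=> 1)) => // x _.
    by rewrite scalrfctE scaleN1r opprK.
  by rewrite LZ//; lra.
have [mu [muX mureg muL]] := @riesz R T cozero X cX clX L LD LZ Lmono L1.
have LN f : CX f -> L (- f) = - L f.
  by move=> cf; rewrite -scaleN1r LZ// mulN1r.
have : g z <= Rintegral mu (X : set borel) g.
  apply: gJ; split => // u Su; rewrite muL; last exact: SC.
  have cu := SC Su; rewrite -lerN2 -LN// (le_trans (Lp _ (cont_withinN cu)))//.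
  by apply: p_le => //; [exact: cont_withinN|move=> x _; rewrite opprK].
rewrite muL// -[L g]opprK -LN// Lg => gp.
have [u [Su ug ue]] := p_app (- g) e (cont_withinN cg) e0.
exists u; split => //; last by move: gp ue; lra.
by move=> x Xx; rewrite (le_trans (ug x Xx))// opprK.
Qed.

(** By compactness finitely many of the functions given by [edwards_pointwise]
    suffice, and [S] is closed under maxima. *)
Theorem edwards (g : T -> R) (e : R) : CX g -> 0 < e ->
  (forall z (mu : probability borel R), X z -> cone_jensen z mu ->
    g z <= Rintegral mu (X : set borel) g) ->
  exists u, S u /\ forall x, X x -> u x <= g x /\ g x < u x + e.
Proof.
move=> cg e0 gJ.
have : forall z, exists u, X z -> [/\ S u, forall x, X x -> u x <= g x & g z < u z + e].
  move=> z; have [Xz|] := pselect (X z); last by exists g.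
  have [u uP] := @edwards_pointwise g z e cg Xz e0 (fun mu => gJ z mu Xz).
  by exists u.
move=> /choice[u uP].
pose O z := ~` [set x | X x /\ e <= g x + - u z x].
have cover_O : X `<=` cover X O.
  by move=> z Xz; exists z => // -[_]; have [_ _] := uP z Xz; lra.
have oO z : X z -> open (O z).
  move=> Xz; apply: closed_openC; apply: cont_within_closed_ge => //.
  by apply: cont_withinD => //; apply: cont_withinN; apply: SC; have [] := uP z Xz.
have := cX; rewrite compact_cover => /(_ _ _ _ oO cover_O)[D DX DO].
have [M gM] := cont_within_bounded cX cg.
have sup_seq (s : seq T) : exists v, [/\ S v, forall x, X x -> v x <= g x &
    forall z, z \in s -> X z -> forall x, X x -> u z x <= v x].
  elim: s => [|z s [v [Sv vg vs]]].
    exists (fun=> - M); split => // x Xx.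
    by have := gM x Xx; rewrite ler_norml => /andP[].
  have [Xz|nXz] := pselect (X z).
    have [Su ug _] := uP z Xz.
    exists (fun x => Num.max (u z x) (v x)); split; first exact: S_max.
    - by move=> x Xx; rewrite ge_max ug//= vg.
    - move=> y; rewrite inE => /orP[/eqP->|ys] Xy x Xx; rewrite le_max ?lexx//.
      by rewrite (vs y ys Xy x Xx) orbT.
  exists v; split => // y; rewrite inE => /orP[/eqP->//|ys]; exact: vs.
have [v [Sv vg vs]] := sup_seq (finmap.enum_fset D).
exists v; split => // x Xx; split; first exact: vg.
have [z /= zD Oz] := DO x Xx.
have Xz : X z by have := DX z zD; rewrite inE.
have : ~ (e <= g x + - u z x) by move=> h; apply: Oz.
by move/negP; rewrite -ltNge; have := vs z zD Xz x Xx; lra.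
Qed.
End Edwards.

(** * Complex normed spaces *)

Section ComplexSpace.
Context {R : realType}.

Section RealNorm.
Context {V : normedModType R[i]}.
Implicit Types x y : V.

(** The norm of [V] takes its values in the nonnegative reals of [R[i]]. *)
Definition rnorm x : R := complex.Re `|x|.

Lemma rnormE x : `|x| = (rnorm x)%:C.
Proof. by rewrite /rnorm RRe_real// ger0_real. Qed.

Lemma rnorm_ge0 x : 0 <= rnorm x.
Proof. by rewrite -lecR -rnormE; exact: normr_ge0. Qed.

Lemma rnormB x y : rnorm (x - y) = rnorm (y - x).
Proof. by rewrite /rnorm distrC. Qed.

Lemma rnormN x : rnorm (- x) = rnorm x.
Proof. by rewrite /rnorm normrN. Qed.

Lemma rnormD x y : rnorm (x + y) <= rnorm x + rnorm y.
Proof. by rewrite -lecR rmorphD /= -!rnormE ler_normD. Qed.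

Lemma rnorm_triangle x y z : rnorm (x - z) <= rnorm (x - y) + rnorm (y - z).
Proof. by rewrite (_ : x - z = (x - y) + (y - z)) ?rnormD// addrA subrK. Qed.

Lemma nbhs_rnorm x (P : set V) : nbhs x P <->
  exists2 e : R, 0 < e & forall y, rnorm (x - y) < e -> P y.
Proof.
split=> [/nbhs_normP[/= e e0 eP]|[e e0 eP]].
  have er : e = (complex.Re e)%:C by rewrite RRe_real// gtr0_real.
  exists (complex.Re e); first by rewrite -ltcR -er.
  move=> y xy; apply: eP; rewrite /= rnormE er.
  by rewrite ltcR.
apply/nbhs_normP; exists e%:C => /=; first by rewrite ltcR.
by move=> y /=; rewrite rnormE ltcR; exact: eP.
Qed.

Lemma near_rnorm x (P : V -> Prop) :
  (exists2 e : R, 0 < e & forall y, rnorm (x - y) < e -> P y) ->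
  \forall y \near x, P y.
Proof. by move/nbhs_rnorm. Qed.

Lemma rnorm_lipschitz_continuous (f : V -> R) :
  (forall x y, `|f x - f y| <= rnorm (x - y)) -> continuous f.
Proof.
move=> fl x; apply/cvgrPdist_lt => e e0.
by apply: near_rnorm; exists e => // y xy; exact: le_lt_trans (fl x y) xy.
Qed.

Lemma rnorm_continuous : continuous rnorm.
Proof.
apply: rnorm_lipschitz_continuous => x y; rewrite ler_distl; apply/andP; split.
  by have := rnorm_triangle y x 0; rewrite !subr0 (rnormB y x); lra.
by have := rnorm_triangle x y 0; rewrite !subr0; lra.
Qed.

(** The distance to the complement, truncated at [1] so that it makes sense for
    the whole space, is positive exactly on [U]. *)
Lemma cozero (U : set V) : open U -> exists d : V -> R,
  continuous d /\ forall x, 0 <= d x /\ (0 < d x <-> U x).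
Proof.
move=> oU; pose A x := [set s | s = 1 \/ exists2 y, ~ U y & s = rnorm (x - y)].
pose d x := inf (A x).
have hA x : has_inf (A x).
  split; first by exists 1; left.
  by exists 0 => _ [->//|[y _ ->]]; exact: rnorm_ge0.
have d0 x : 0 <= d x.
  by apply: lb_le_inf; [have [] := hA x|move=> _ [->//|[y _ ->]]; exact: rnorm_ge0].
have dl x y : d x <= d y + rnorm (x - y).
  rewrite -lerBlDr; apply: lb_le_inf; first by have [] := hA y.
  move=> _ [->|[z nUz ->]].
    have : d x <= 1 by apply: ge_inf; [have [] := hA x|left].
    by have := rnorm_ge0 (x - y); lra.
  have : d x <= rnorm (x - z) by apply: ge_inf; [have [] := hA x|right; exists z].
  by have := rnorm_triangle x y z; lra.
exists d; split.
  apply: rnorm_lipschitz_continuous => x y; rewrite ler_distl.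
  by have := dl x y; have := dl y x; rewrite (rnormB y x) => h1 h2; apply/andP; split; lra.
move=> x; split=> //; split=> [dx|Ux].
  apply: contrapT => nU; have : d x <= rnorm (x - x).
    by apply: ge_inf; [have [] := hA x|right; exists x].
  by rewrite /rnorm subrr normr0 leNgt dx.
have /nbhs_rnorm[e e0 eU] : nbhs x U by exact: open_nbhs_nbhs.
apply: (@lt_le_trans _ _ (Num.min e 1)); first by rewrite lt_min e0 ltr01.
apply: lb_le_inf; first by have [] := hA x.
move=> _ [->|[y nU ->]]; first by rewrite ge_min lexx orbT.
by rewrite ge_min leNgt; apply/orP; left; apply/negP => /eU.
Qed.

End RealNorm.

Lemma ReIm_continuous : continuous (fun p : R * R => p.1 +i* p.2 : R[i]).
Proof.
move=> [a b]; apply/cvgrPdist_lt => e e0.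
have er : e = (complex.Re e)%:C by rewrite RRe_real// gtr0_real.
have e0' : 0 < complex.Re e / 2 by rewrite divr_gt0// -ltcR -er.
near=> p.
have h1 : `|a - p.1| < complex.Re e / 2.
  near: p; exact: (@cvgr_dist_lt _ _ _ _ _ fst a (@cvg_fst _ _ (nbhs a) (nbhs b) _) _ e0').
have h2 : `|b - p.2| < complex.Re e / 2.
  near: p; exact: (@cvgr_dist_lt _ _ _ _ _ snd b (@cvg_snd _ _ (nbhs a) (nbhs b) _) _ e0').
have -> : (a +i* b) - (p.1 +i* p.2) = (a - p.1)%:C + 'i * (b - p.2)%:C :> R[i].
  by apply/eqP; rewrite eq_complex /=; apply/andP; split; apply/eqP; ring.
apply: (le_lt_trans (ler_normD _ _)); rewrite normrM er.
have -> : `|'i : R[i]| = 1 by rewrite normc_def /= expr0n expr1n add0r sqrtr1.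
rewrite mul1r.
have Cn (u : R) : `|u%:C : R[i]| = `|u|%:C.
  by rewrite normc_def /= expr0n addr0 sqrtr_sqr.
rewrite !Cn -rmorphD ltcR; lra.
Unshelve. all: by end_near. Qed.

Lemma compact_disc (M : R) : compact [set z : R[i] | `|z| <= M%:C].
Proof.
pose Q := `[- M, M]%classic `*` `[- M, M]%classic.
have cQ : compact ((fun p : R * R => p.1 +i* p.2 : R[i]) @` Q).
  apply: continuous_compact.
    by apply: continuous_subspaceT; exact: ReIm_continuous.
  by apply: compact_setX; exact: segment_compact.
apply: (subclosed_compact _ cQ).
  rewrite (_ : [set z | _] = @rnorm R[i] @^-1` [set y | y <= M]).
    by move/continuous_closedP: (@rnorm_continuous R[i]); apply; exact: closed_le.
  by apply/seteqP; split => z /=; rewrite rnormE lecR.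
move=> [a b] /=; rewrite normc_def /= lecR => h.
have bnd (u v : R) : Num.sqrt (u ^+ 2 + v ^+ 2) <= M -> - M <= u <= M.
  move=> uv; rewrite -ler_norml (le_trans _ uv)// -sqrtr_sqr ler_sqrt ?lerDl ?sqr_ge0//.
  by rewrite addr_ge0 ?sqr_ge0.
exists (a, b) => //; split; rewrite /= in_itv/=; first exact: bnd h.
by apply: (bnd b a); rewrite addrC.
Qed.

Lemma bounded_closed_compact_complex n (A : set 'rV[R[i]]_n) :
  bounded_set A -> closed A -> compact A.
Proof.
move=> [M [Mr AM]] clA.
have Mre : M = (complex.Re M)%:C by rewrite RRe_real.
have cD : compact [set v : 'rV[R[i]]_n | forall i, `|v ord0 i| <= (complex.Re M + 1)%:C].
  apply: (@rV_compact _ _ (fun=> [set z : R[i] | `|z| <= (complex.Re M + 1)%:C])).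
  by move=> _; exact: compact_disc.
apply: (subclosed_compact clA cD) => v Av i /=.
have := AM (complex.Re M + 1)%:C; rewrite {1}Mre ltcR ltrDl ltr01 => /(_ isT v Av).
apply: le_trans.
rewrite [leRHS]/Num.norm /= mx_normE -[leLHS]nngE num_le.
exact: (le_bigmax _ (fun j : 'I_1 * 'I_n => `|v j.1 j.2|%:nng) (ord0, i)).
Qed.

Definition expi (t : R) : R[i] := cos t +i* sin t.

Lemma expi_continuous : continuous expi.
Proof.
move=> t; apply: (@continuous_comp _ _ _ (fun t => (cos t, sin t))
  (fun p : R * R => p.1 +i* p.2 : R[i])); last exact: ReIm_continuous.
exact: (cvg_pair (@continuous_cos R t) (@continuous_sin R t)).
Qed.

Lemma expiD s t : expi (s + t) = expi s * expi t.
Proof.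
by rewrite /expi cosD sinD; apply/eqP; rewrite eq_complex /= eqxx/=; apply/eqP; ring.
Qed.

Lemma expi0 : expi 0 = 1.
Proof. by rewrite /expi cos0 sin0. Qed.

Lemma expi2pi : expi (pi *+ 2) = 1.
Proof. by rewrite /expi cos2pi sin2pi. Qed.

Lemma norm_expi t : `|expi t| = 1.
Proof. by rewrite normc_def /= cos2Dsin2 sqrtr1. Qed.

Lemma expi_onto (z : R[i]) : `|z| = 1 -> exists2 t, 0 <= t <= pi *+ 2 & z = expi t.
Proof.
case: z => x y; rewrite normc_def /= => -[] h.
have xy : x ^+ 2 + y ^+ 2 = 1.
  have := congr1 (fun u => u ^+ 2) h; rewrite sqr_sqrtr ?expr1n//.
  by rewrite addr_ge0 ?sqr_ge0.
have x1 : -1 <= x <= 1.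
  rewrite -ler_norml -(@ler_pXn2r _ 2) ?nnegrE// expr1n.
  by rewrite real_normK ?num_real//; have := sqr_ge0 y; lra.
have yE : y ^+ 2 = 1 - x ^+ 2 by lra.
have acx : 0 <= acos x <= pi by rewrite acos_ge0// acos_lepi.
have pi0 := @pi_ge0 R.
have [y0|y0] := lerP 0 y.
  exists (acos x); first by rewrite mulr2n; lra.
  rewrite /expi acosK// sin_acos// -yE sqrtr_sqr ger0_norm//.
exists (pi *+ 2 - acos x); first by rewrite mulr2n; lra.
rewrite expiD expi2pi mul1r /expi cosN sinN acosK// sin_acos// -yE sqrtr_sqr ltr0_norm//.
by rewrite opprK.
Qed.

End ComplexSpace.

(** * Means over the unit circle *)

Section CircleMean.
Context {R : realType}.
Implicit Types G H : R -> R.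
Notation leb := (@lebesgue_measure R).

Definition mean G : R := (2 * pi)^-1 * Rintegral leb `[0, 2 * pi]%classic G.

Lemma twopi_gt0 : 0 < 2 * pi :> R.
Proof. by rewrite mulr_gt0// pi_gt0. Qed.

Lemma itv_integrable a b G : continuous G ->
  leb.-integrable `[a, b]%classic (EFin \o G).
Proof.
move=> cG; apply: continuous_compact_integrable; first exact: segment_compact.
exact: continuous_subspaceT.
Qed.

Lemma mean_le G H : continuous G -> continuous H -> (forall t, G t <= H t) ->
  mean G <= mean H.
Proof.
move=> cG cH GH; rewrite ler_pM2l ?invr_gt0 ?twopi_gt0//.
by apply: le_Rintegral => //; exact: itv_integrable.
Qed.

Lemma meanD G H : continuous G -> continuous H -> mean (fun t => G t + H t) = mean G + mean H.
Proof.
by move=> cG cH; rewrite /mean RintegralD ?mulrDr//; exact: itv_integrable.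
Qed.

Lemma meanZ c G : continuous G -> mean (fun t => c * G t) = c * mean G.
Proof.
move=> cG; rewrite /mean RintegralZl//; last exact: itv_integrable.
exact: mulrCA.
Qed.

Lemma mean_cst c : mean (fun=> c) = c.
Proof.
rewrite /mean Rintegral_cst//= lebesgue_measure_itv/= lte_fin twopi_gt0 /=.
by rewrite subr0 mulrCA mulVf ?mulr1// gt_eqF// twopi_gt0.
Qed.

Lemma primitive_exists G (c : R) : continuous G -> exists F : R -> R,
  (forall x : R, c < x -> is_derive x 1 F (G x)) /\
  (forall a b, c < a -> a < b -> Rintegral leb `[a, b]%classic G = F b - F a).
Proof.
move=> cG; pose F x := Rintegral leb `[c, x]%classic G.
have dF (x : R) : c < x -> is_derive x 1 F (G x).
  move=> cx; have x1 : x < x + 1 by rewrite ltrDl.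
  have [dF F'] := continuous_FTC1_closed x1 (@itv_integrable c (x + 1) G cG) cx (cG x).
  apply: DeriveDef; first exact: dF.
  by rewrite -derive1E; exact: F'.
exists F; split => // a b ca ab.
rewrite /Rintegral (@continuous_FTC2 R G F a b)//.
- exact: continuous_subspaceT.
- split.
  + move=> x; rewrite in_itv/= => /andP[ax _].
    by have [] := dF x (lt_trans ca ax).
  + apply: cvg_at_right_filter; apply/differentiable_continuous/derivable1_diffP.
    by have [] := dF a ca.
  + apply: cvg_at_left_filter; apply/differentiable_continuous/derivable1_diffP.
    by have [] := dF b (lt_trans ca ab).
- move=> x; rewrite in_itv/= => /andP[ax _].
  by have [_ <-] := dF x (lt_trans ca ax); rewrite derive1E.
Qed.

Lemma primitive_MVT G F (c a b : R) : (forall x : R, c < x -> is_derive x 1 F (G x)) ->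
  c < a -> a < b -> exists2 x, a < x < b & F b - F a = G x * (b - a).
Proof.
move=> dF ca ab; have [||x] := @MVT R F G a b ab.
- by move=> x; rewrite in_itv/= => /andP[ax _]; exact: dF (lt_trans ca ax).
- apply: derivable_within_continuous => x; rewrite in_itv/= => /andP[ax _].
  by have [] := dF x (lt_le_trans ca ax).
- by rewrite in_itv/=; exists x.
Qed.

(** By the mean value theorem for a primitive, [G] takes the value [m] in every
    subinterval. *)
Lemma mean_eq_max G (m : R) : continuous G -> (forall t, G t <= m) -> m <= mean G ->
  forall t : R, 0 <= t <= 2 * pi -> G t = m.
Proof.
move=> cG Gm mG; have [F [dF FE]] := primitive_exists (-1) cG.
have p0 := twopi_gt0.
have slope a b : -1 < a -> a <= b -> F b - F a <= m * (b - a).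
  move=> a1; rewrite le_eqVlt => /orP[/eqP->|ab]; first by rewrite !subrr mulr0.
  have [x _ ->] := primitive_MVT dF a1 ab.
  by rewrite ler_pM2r ?subr_gt0.
have total : m * (2 * pi) <= F (2 * pi) - F 0.
  by rewrite -FE ?ltrN10// mulrC -ler_pdivlMl.
have dense a b : 0 <= a -> a < b -> b <= 2 * pi -> exists2 x, a < x < b & G x = m.
  move=> a0 ab b2.
  have a1 : -1 < a by rewrite (lt_le_trans _ a0)// ltrN10.
  have [x xab E] := primitive_MVT dF a1 ab.
  exists x => //; apply/eqP; rewrite eq_le Gm/=.
  have ab0 : 0 < b - a by rewrite subr_gt0.
  rewrite -(ler_pM2r ab0) -E.
  have s1 := slope 0 a ltac:(by rewrite ltrN10) a0.
  have s2 := slope b (2 * pi) (lt_trans a1 ab) b2.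
  by move: total s1 s2; rewrite subr0; lra.
move=> t /andP[t0 t2]; apply/eqP; rewrite eq_le Gm/= leNgt; apply/negP => Gt.
have mGt : 0 < m - G t by rewrite subr_gt0.
have /(@cvgrPdist_lt _ _ _ _ _ G (G t))/(_ _ mGt) := cG t.
move=> /nbhs_ballP[e /= e0 eG].
have eG' x : `|t - x| < e -> G x < m.
  by move=> /eG/=; rewrite ltr_distl => /andP[]; lra.
have [tp|tp] := ltP t (2 * pi).
  have [|||x /andP[x1 x2] Gx] := dense t (Num.min (t + e / 2) (2 * pi)) => //.
  - by rewrite lt_min tp andbT ltrDl divr_gt0.
  - by rewrite ge_min lexx orbT.
  have : G x < m; last by rewrite Gx ltxx.
  move: x2; rewrite lt_min => /andP[x2 _].
  by apply: eG'; rewrite ltr_distl; apply/andP; split; lra.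
have [|||x /andP[x1 x2] Gx] := dense (Num.max (t - e / 2) 0) (2 * pi) => //.
- by rewrite le_max lexx orbT.
- by rewrite gt_max p0 andbT; lra.
have : G x < m; last by rewrite Gx ltxx.
move: x1; rewrite gt_max => /andP[x1 _].
by apply: eG'; rewrite ltr_distl; apply/andP; split; lra.
Qed.

Lemma uniform_continuous_segment G (a b e : R) : continuous G -> 0 < e ->
  exists2 d, 0 < d & forall x y : R, a <= x <= b -> `|x - y| < d -> `|G x - G y| < e.
Proof.
move=> cG e0; have e2 : 0 < e / 2 by rewrite divr_gt0.
have /compact_near_coveringP := @segment_compact R a b.
move=> /(_ R (0^'+) (fun d x => forall y, `|x - y| < d -> `|G x - G y| < e) _).
have H x : `[a, b]%classic x -> \forall x' \near x & d \near 0^'+,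
    forall y, `|x' - y| < d -> `|G x' - G y| < e.
  move=> _; have /(@cvgrPdist_lt _ _ _ _ _ G (G x))/(_ _ e2) := cG x.
  move=> /nbhs_ballP[r /= r0 rG].
  have r2 : 0 < r / 2 by rewrite divr_gt0.
  near=> x' d => y xy.
  have xx' : `|x - x'| < r / 2.
    by near: x'; apply/nbhs_ballP; exists (r / 2).
  have dr : d < r / 2 by near: d; exact: nbhs_right_lt.
  have rr : r / 2 < r by rewrite ltr_pdivrMr// ltr_pMr// ltr1n.
  have h1 : `|G x - G x'| < e / 2 by apply: rG; exact: lt_trans xx' rr.
  have h2 : `|G x - G y| < e / 2.
    apply: rG; apply: (le_lt_trans (ler_distD x' x y)).
    by rewrite [ltRHS]splitr ltrD// (lt_trans xy).
  by have := ler_distD (G x) (G x') (G y); rewrite (distrC (G x') (G x)); lra.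
move=> /(_ H) /= Hd.
near (0:R)^'+ => d; exists d; first by near: d; exact: nbhs_right_gt.
move=> x y xab; have : `[a, b]%classic x by rewrite /= in_itv.
by move: x y xab; near: d; apply: filterS Hd => d Hd x y xab xI; exact: Hd.
Unshelve. all: by end_near. Qed.

(** The Riemann sum approximates the increments of a primitive of [G], which
    telescope to the increment over a full period.  By periodicity the latter is
    independent of the starting point [a], so that one [N] serves for all [a]. *)
Lemma mean_riemann G (e : R) : continuous G -> (forall t, G (t + 2 * pi) = G t) -> 0 < e ->
  exists N : nat, forall a : R, 0 <= a <= 2 * pi ->
    N.+1%:R^-1 * \sum_(k < N.+1) G (a + k%:R * (2 * pi / N.+1%:R)) <= mean G + e.
Proof.
move=> cG pG e0; have [F [dF FE]] := primitive_exists (-1) cG.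
have p0 := twopi_gt0.
have [d d0 dG] := @uniform_continuous_segment G 0 (2 * pi + 2 * pi) e cG e0.
pose N := Num.bound (2 * pi / d); exists N => a /andP[a0 a2].
pose h : R := 2 * pi / N.+1%:R.
have h0 : 0 < h by rewrite divr_gt0// ltr0n.
have hd : h < d.
  rewrite ltr_pdivrMr ?ltr0n// [ltRHS]mulrC -ltr_pdivrMr//.
  have q0 : 0 <= 2 * pi / d by rewrite divr_ge0// ltW.
  by rewrite (lt_le_trans (archi_boundP q0))// ler_nat.
have hN : N.+1%:R * h = 2 * pi by rewrite mulrC divfK// pnatr_eq0.
have shift : F (a + 2 * pi) - F a = F (2 * pi) - F 0.
  have [->|an0] := eqVneq a 0; first by rewrite add0r.
  have a1 : 0 < a by rewrite lt_neqAle eq_sym an0.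
  have dP (x : R) : -1 < x ->
      is_derive x 1 (fun x => F (x + 2 * pi) - F x) (G (x + 2 * pi) - G x).
    move=> x1; apply: is_deriveB; last exact: dF.
    have dx : is_derive (x + 2 * pi) 1 F (G (x + 2 * pi)) by apply: dF; lra.
    have := @is_derive1_comp _ F (shift (2 * pi)) x _ _ dx (is_derive_shift _ _ _).
    by rewrite mulr1.
  have N10 : (-1 : R) < 0 by rewrite ltrN10.
  have [x _] := primitive_MVT dP N10 a1.
  by rewrite pG subrr mul0r add0r; lra.
have step (k : nat) : (k < N.+1)%N ->
    (G (a + k%:R * h) - e) * h <= F (a + k.+1%:R * h) - F (a + k%:R * h).
  move=> kN; have k0 : 0 <= k%:R * h by rewrite mulr_ge0// ltW.
  have kh : a + k.+1%:R * h = a + k%:R * h + h by rewrite -natr1; ring.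
  have k1 : -1 < a + k%:R * h by lra.
  have k2 : a + k%:R * h < a + k.+1%:R * h by lra.
  have [x /andP[x1 x2] ->] := primitive_MVT dF k1 k2.
  rewrite (_ : a + k.+1%:R * h - (a + k%:R * h) = h); last by lra.
  rewrite ler_pM2r//.
  have : `|G (a + k%:R * h) - G x| < e.
    apply: dG.
      have : k%:R * h <= N.+1%:R * h by rewrite ler_pM2r// ler_nat ltnW.
      by rewrite hN => ?; apply/andP; split; lra.
    by rewrite ltr_distl; apply/andP; split; lra.
  by rewrite ltr_distl => /andP[]; lra.
have sumF : \sum_(k < N.+1) (F (a + k.+1%:R * h) - F (a + k%:R * h)) = F (2 * pi) - F 0.
  rewrite -(big_mkord xpredT (fun k => F (a + k.+1%:R * h) - F (a + k%:R * h))).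
  rewrite (@GRing.telescope_sumr_eq _ 0%N N.+1 (fun k => F (a + k%:R * h)))//.
  by rewrite hN mul0r addr0 shift.
have sum_le : \sum_(k < N.+1) (G (a + k%:R * h) - e) * h <= F (2 * pi) - F 0.
  by rewrite -sumF; apply: ler_sum => k _; exact: step.
have mE : mean G = (F (2 * pi) - F 0) / (2 * pi).
  by rewrite /mean FE ?ltrN10// mulrC.
rewrite -/h mE -lerBlDr ler_pdivlMr//.
move: sum_le; rewrite -mulr_suml sumrB sumr_const card_ord.
set s := \sum_(i < _) _.
suff -> : (s - e *+ N.+1) * h = (N.+1%:R^-1 * s - e) * (2 * pi) by [].
rewrite /h -(mulr_natr e); field.
by rewrite nat1r pnatr_eq0.
Qed.

End CircleMean.

(** * The maximum principle and locality of plurisubharmonicity *)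

Lemma continuous_sum_at (R : realType) (X : topologicalType) (I : Type) (s : seq I)
    (f : I -> X -> R) (x : X) : (forall i, {for x, continuous (f i)}) ->
  {for x, continuous (fun y => \sum_(i <- s) f i y)}.
Proof.
move=> cf; elim: s => [|i s IH].
  have E : (fun y => \sum_(i <- [::]) f i y) = fun=> 0.
    by apply/funext => y; rewrite big_nil.
  by change (continuous_at x (fun y => \sum_(i <- [::]) f i y)); rewrite E; exact: cvg_cst.
have E : (fun y => \sum_(j <- i :: s) f j y) = f i + (fun y => \sum_(j <- s) f j y).
  by apply/funext => y; rewrite big_cons.
change (continuous_at x (fun y => \sum_(j <- i :: s) f j y)); rewrite E.
exact: (cvgD (cf i) IH).
Qed.

Lemma mean_sum (R : realType) (I : Type) (s : seq I) (G : I -> R -> R) :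
  (forall i, continuous (G i)) ->
  mean (fun t => \sum_(i <- s) G i t) = \sum_(i <- s) mean (G i).
Proof.
move=> cG; elim: s => [|i s IH].
  by under eq_fun do rewrite big_nil; rewrite big_nil mean_cst.
under eq_fun do rewrite big_cons; rewrite big_cons -IH -meanD//.
by move=> t; apply: continuous_sum_at => j; exact: cG.
Qed.

Section PshReal.
Context {R : realType} {V : normedModType R[i]}.
Implicit Types (U : set V) (u : V -> R).

Definition cont_at U u : Prop := forall x, U x -> {for x, continuous u}.

(** It suffices to state the submean inequality for unit circles, since [b]
    ranges over all vectors. *)
Definition psh_on U u : Prop := forall a b : V,
  (forall z : R[i], `|z| <= 1 -> U (a + z *: b)) ->
  u a <= mean (fun t => u (a + expi t *: b)).

Lemma line_continuous (a b : V) : continuous (fun z : R[i] => a + z *: b).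
Proof.
by move=> z; exact: (cvgD (cvg_cst a) (@scalel_continuous _ _ b z)).
Qed.

Lemma circle_continuous U u (a b : V) : cont_at U u ->
  (forall t, U (a + expi t *: b)) -> continuous (fun t => u (a + expi t *: b)).
Proof.
move=> cu Uab t; apply: (@continuous_comp _ _ _ (fun t => a + expi t *: b) u).
  apply: (@continuous_comp _ _ _ (@expi R) (fun z => a + z *: b)).
    exact: expi_continuous.
  exact: line_continuous.
exact: cu.
Qed.

Lemma rnormZ (z : R[i]) (x : V) : rnorm (z *: x) = rnorm z * rnorm x.
Proof.
have : (rnorm (z *: x))%:C = (rnorm z * rnorm x)%:C :> R[i].
  by rewrite rmorphM /= -!rnormE normrZ.
by case.
Qed.
End PshReal.

Section MaxPrinciple.
Context {R : realType}.
Implicit Types (f : R[i] -> R) (z : R[i]).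

Lemma rnorm_real (s : R) : 0 <= s -> rnorm (s%:C : R[i]) = s.
Proof. by move=> s0; rewrite /rnorm ger0_norm// lecR. Qed.

Lemma rnorm_expi (t : R) : rnorm (expi t) = 1.
Proof. by rewrite /rnorm norm_expi. Qed.

Lemma rnormM z z' : rnorm (z * z') = rnorm z * rnorm z'.
Proof. exact: (@rnormZ R R[i]). Qed.

Lemma polar z : exists2 t : R, 0 <= t <= 2 * pi & z = (rnorm z)%:C * expi t.
Proof.
have [->|z0] := eqVneq z 0.
  exists 0; last by rewrite /rnorm normr0 mul0r.
  by rewrite lexx mulr_ge0// pi_ge0.
have n0 : `|z| != 0 by rewrite normr_eq0.
have [|t t2 zE] := @expi_onto R (z / `|z|).
  by rewrite normrM normfV normr_id divff.
exists t; first by rewrite mulr_natl.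
by rewrite -zE -rnormE mulrC divfK.
Qed.

(** Among the points of the closed disc where [f] is maximal, one of largest
    modulus lies on the boundary: otherwise [f] would be constant on a small
    circle around it, which reaches farther out. *)
Lemma max_principle_disc f :
  (forall z, rnorm z <= 1 -> {for z, continuous f}) ->
  (forall z, rnorm z < 1 -> exists s : R, [/\ 0 < s, rnorm z + s <= 1 &
     f z <= mean (fun t => f (z + expi t *: (s%:C : R[i])))]) ->
  exists z1, rnorm z1 = 1 /\ forall z, rnorm z <= 1 -> f z <= f z1.
Proof.
move=> cf sub; pose D := [set z : R[i] | rnorm z <= 1].
have DE : D = [set z : R[i] | `|z| <= 1%:C].
  by apply/seteqP; split => z /=; rewrite rnormE lecR.
have cD : compact D by rewrite DE; exact: compact_disc.
have clD : closed D.
  rewrite (_ : D = @rnorm R R[i] @^-1` [set y | y <= 1])//.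
  by move/continuous_closedP: (@rnorm_continuous R R[i]); apply; exact: closed_le.
have cfD : cont_within D f.
  by apply: continuous_in_subspaceT => z; rewrite inE; exact: cf.
have D0 : D !=set0 by exists 0; rewrite /D /= /rnorm normr0 ler01.
have [z0 z0D z0max] := compact_EVT_max D0 cD cfD.
rewrite inE in z0D.
pose A := [set z | D z /\ f z0 <= f z].
have clA : closed A by exact: cont_within_closed_ge.
have cA : compact A by apply: (subclosed_compact clA cD) => z [].
have A0 : A !=set0 by exists z0.
have [z1 z1A z1max] := compact_EVT_max A0 cA (cont_withinW (@rnorm_continuous R R[i])).
move: z1A; rewrite inE => -[Dz1 fz1].
have fmax z : D z -> f z <= f z0 by move=> Dz; apply: z0max; rewrite inE.
exists z1; split; last by move=> z Dz; rewrite (le_trans (fmax z Dz)).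
apply/eqP; rewrite eq_le Dz1/= leNgt; apply/negP => z1lt.
have [s [s0 s1 fs]] := sub _ z1lt.
have circD t : D (z1 + expi t *: (s%:C : R[i])).
  rewrite /D /= (le_trans (rnormD _ _))// rnormZ rnorm_expi mul1r rnorm_real//.
  exact: ltW.
have cG : continuous (fun t => f (z1 + expi t *: (s%:C : R[i]))).
  exact: (circle_continuous cf).
have [t t2 z1E] := polar z1.
have := mean_eq_max cG (fun t => fmax _ (circD t)) (le_trans fz1 fs) t2.
move=> fE; have : (z1 + expi t *: (s%:C : R[i])) \in A.
  by rewrite inE; split; [exact: circD|rewrite fE].
move/z1max; rewrite {1}z1E /GRing.scale /= [expi t * _]mulrC -mulrDl.
rewrite rnormM rnorm_expi mulr1 -rmorphD rnorm_real ?addr_ge0 ?rnorm_ge0 ?(ltW s0)//.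
by rewrite leNgt ltrDl s0.
Qed.
End MaxPrinciple.

Section LocalGlobal.
Context {R : realType} {V : normedModType R[i]}.

(** Averaging over the rotations by the roots of unity makes the values on the
    unit circle almost constant, equal to the circle mean, while keeping the
    value at the centre; the maximum principle for the averaged function then
    compares the two. *)
Theorem psh_on_local (U : set V) (u : V -> R) : cont_at U u ->
  (forall x, U x -> exists W, [/\ open W, W x & psh_on W u]) -> psh_on U u.
Proof.
move=> cu loc a b Uab.
have Uabr (z : R[i]) : rnorm z <= 1 -> U (a + z *: b).
  by move=> z1; apply: Uab; rewrite rnormE lecR.
have Ucirc t : U (a + expi t *: b) by apply: Uabr; rewrite rnorm_expi.
pose G t := u (a + expi t *: b).
have cG : continuous G by exact: (circle_continuous cu).
have pG t : G (t + 2 * pi) = G t.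
  by rewrite /G expiD mulr_natl expi2pi mulr1.
apply/ler_addgt0Pr => e e0.
have [N GN] := mean_riemann cG pG e0.
pose rot (k : nat) : R[i] := expi (k%:R * (2 * pi / N.+1%:R)).
pose W (z : R[i]) := N.+1%:R^-1 * \sum_(k < N.+1) u (a + z *: (rot k *: b)).
have rotU (k : nat) (z : R[i]) : rnorm z <= 1 -> U (a + z *: (rot k *: b)).
  by move=> z1; rewrite scalerA; apply: Uabr; rewrite rnormM rnorm_expi mulr1.
have [||z1 [z1n Wmax]] := @max_principle_disc R W.
- move=> z z1.
  have cS : {for z, continuous (fun z : R[i] => \sum_(k < N.+1) u (a + z *: (rot k *: b)))}.
    apply: continuous_sum_at => k.
    apply: (@continuous_comp _ _ _ (fun z : R[i] => a + z *: (rot k *: b)) u).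
      exact: line_continuous.
    by apply: cu; exact: rotU.
  exact: (cvgM (cvg_cst _) cS).
- move=> z z1; have z1' := ltW z1.
  have sub1 (k : 'I_N.+1) : \forall s \near (0:R)^'+,
      u (a + z *: (rot k *: b)) <=
      mean (fun t => u (a + (z + expi t *: (s%:C : R[i])) *: (rot k *: b))).
    have [B [openB Bx pB]] := loc _ (rotU k z z1').
    have /nbhs_rnorm[r r0 rB] : nbhs (a + z *: (rot k *: b)) B by exact: open_nbhs_nbhs.
    near=> s.
    have s0 : 0 < s by near: s; exact: nbhs_right_gt.
    have sr : s * (rnorm b + 1) < r.
      rewrite -ltr_pdivlMr ?ltr_wpDl ?rnorm_ge0//.
      by near: s; apply: nbhs_right_lt; rewrite divr_gt0 ?ltr_wpDl ?rnorm_ge0.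
    have := pB (a + z *: (rot k *: b)) (s%:C *: (rot k *: b)).
    under eq_fun => t do rewrite -addrA [expi t *: _]scalerA -scalerDl.
    apply => y; rewrite rnormE lecR => y1; apply: rB.
    rewrite opprD addNKr rnormN !rnormZ rnorm_expi mul1r rnorm_real ?ltW//.
    apply: le_lt_trans sr; rewrite mulrCA ler_pM2l//.
    by rewrite (le_trans (ler_wpM2r (rnorm_ge0 b) y1))// mul1r lerDl.
  near (0:R)^'+ => s; exists s.
  have s0 : 0 < s by near: s; exact: nbhs_right_gt.
  have s1 : rnorm z + s <= 1.
    by rewrite -lerBrDl; near: s; apply: nbhs_right_le; rewrite subr_gt0.
  split => //.
  have sk : forall k : 'I_N.+1, u (a + z *: (rot k *: b)) <=
      mean (fun t => u (a + (z + expi t *: (s%:C : R[i])) *: (rot k *: b))).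
    by near: s; apply: filter_forall => k; exact: sub1.
  have cH (k : 'I_N.+1) :
      continuous (fun t => u (a + (z + expi t *: (s%:C : R[i])) *: (rot k *: b))).
    under eq_fun => t do rewrite scalerDl addrA -[(expi t *: _) *: _]scalerA.
    apply: (circle_continuous cu) => t.
    rewrite [expi t *: _]scalerA -addrA -scalerDl; apply: rotU.
    by rewrite (le_trans (rnormD _ _))// rnormM rnorm_expi mul1r rnorm_real// ltW.
  rewrite /W meanZ; last by move=> t; apply: continuous_sum_at => k; exact: cH.
  rewrite ler_pM2l ?invr_gt0 ?ltr0n// mean_sum//.
  by apply: ler_sum => k _; exact: sk.
have -> : u a = W 0.
  rewrite /W; under eq_bigr do rewrite scale0r addr0.
  by rewrite sumr_const card_ord -[u a *+ _]mulr_natl mulrA mulVf ?mul1r// pnatr_eq0.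
have [t t2] := polar z1; rewrite z1n rmorph1 mul1r => z1E.
have W0 : rnorm (0 : R[i]) <= 1 by rewrite /rnorm normr0 ler01.
rewrite (le_trans (Wmax 0 W0))//.
rewrite (le_trans _ (GN t t2))//.
by rewrite /W z1E; under eq_bigr => k _ do rewrite /rot scalerA -expiD.
Unshelve. all: by end_near. Qed.
End LocalGlobal.

(** * The cone of continuous plurisubharmonic functions *)

Section Cone.
Context {R : realType} {V : normedModType R[i]}.
Implicit Types (U : set V) (u v : V -> R).

Lemma psh_onS U U' u : U `<=` U' -> psh_on U' u -> psh_on U u.
Proof. by move=> UU' pu a b Uab; apply: pu => z z1; apply: UU'; exact: Uab. Qed.

Lemma cont_atS U U' u : U `<=` U' -> cont_at U' u -> cont_at U u.
Proof. by move=> UU' cu x /UU'; exact: cu. Qed.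

Lemma disc_circle U (a b : V) : (forall z : R[i], `|z| <= 1 -> U (a + z *: b)) ->
  forall t, U (a + expi t *: b).
Proof. by move=> Uab t; apply: Uab; rewrite norm_expi. Qed.

Lemma psh_on_cst U c : psh_on U (fun=> c).
Proof. by move=> a b _; rewrite mean_cst. Qed.

Lemma psh_onD U u v : cont_at U u -> cont_at U v -> psh_on U u -> psh_on U v ->
  psh_on U (fun x => u x + v x).
Proof.
move=> cu cv pu pv a b Uab; have Uc := disc_circle Uab.
rewrite meanD; first by rewrite lerD ?pu ?pv.
- exact: (circle_continuous cu).
- exact: (circle_continuous cv).
Qed.

Lemma psh_onZ U c u : 0 <= c -> cont_at U u -> psh_on U u ->
  psh_on U (fun x => c * u x).
Proof.
move=> c0 cu pu a b Uab; have Uc := disc_circle Uab.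
by rewrite meanZ; [rewrite ler_wpM2l ?pu|exact: (circle_continuous cu)].
Qed.

Lemma cont_atD U u v : cont_at U u -> cont_at U v -> cont_at U (fun x => u x + v x).
Proof. by move=> cu cv x Ux; exact: (cvgD (cu x Ux) (cv x Ux)). Qed.

Lemma cont_atZ U c u : cont_at U u -> cont_at U (fun x => c * u x).
Proof. by move=> cu x Ux; exact: (cvgM (cvg_cst _) (cu x Ux)). Qed.

Lemma cont_at_max U u v : cont_at U u -> cont_at U v ->
  cont_at U (fun x => Num.max (u x) (v x)).
Proof. by move=> cu cv x Ux; exact: (continuous_max (cu x Ux) (cv x Ux)). Qed.

Lemma cont_at_cst U c : cont_at U (fun=> c : R).
Proof. by move=> x _; exact: cvg_cst. Qed.

Lemma psh_on_max U u v : cont_at U u -> cont_at U v -> psh_on U u -> psh_on U v ->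
  psh_on U (fun x => Num.max (u x) (v x)).
Proof.
move=> cu cv pu pv a b Uab; have Uc := disc_circle Uab.
have cm := circle_continuous (cont_at_max cu cv) Uc.
rewrite ge_max; apply/andP; split.
- apply: (le_trans (pu a b Uab)); apply: mean_le => //.
    exact: (circle_continuous cu).
  by move=> t; rewrite le_max lexx.
- apply: (le_trans (pv a b Uab)); apply: mean_le => //.
    exact: (circle_continuous cv).
  by move=> t; rewrite le_max lexx orbT.
Qed.
Lemma cont_at_eq (O : set V) (g h : V -> R) : open O ->
  (forall x, O x -> g x = h x) -> cont_at O g -> cont_at O h.
Proof.
move=> oO' gh cg; apply: (@cont_within_open _ _ O) => //; apply: (@cont_within_eq _ _ _ g) => //.
by apply: continuous_in_subspaceT => x; rewrite inE; exact: cg.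
Qed.

Lemma psh_on_eq (O : set V) (g h : V -> R) :
  (forall x, O x -> g x = h x) -> psh_on O g -> psh_on O h.
Proof.
move=> gh pg a b Oab; have Oc := disc_circle Oab.
have Oa : O a by have := Oab 0; rewrite normr0 scale0r addr0; apply.
by under eq_fun => t do rewrite -(gh _ (Oc t)); rewrite -gh//; exact: pg.
Qed.
End Cone.

(** * Approximation of plurisubharmonic functions on compact sets *)

Section PshCompact.
Context {R : realType} {n : nat}.
Notation T := 'rV[R[i]]_n.
Implicit Types (X U : set T) (u : T -> R).

Lemma circle_mean_real (w : R[i] -> \bar R) (a : R[i]) (r : R) (G : R -> R) :
  continuous G -> (forall t, 0 <= t <= 2 * pi -> w (circle_point a r t) = (G t)%:E) ->
  circle_mean w a r = (mean G)%:E.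
Proof.
move=> cG wG; rewrite /circle_mean /mean EFinM; congr (_ * _)%E.
rewrite fineK; last by apply: integrable_fin_num => //; exact: itv_integrable.
by apply: eq_integral => t; rewrite inE/= in_itv/= => t2; rewrite wG.
Qed.

Lemma cont_within_usc (S : topologicalType) (X : set S) (u : S -> R) :
  cont_within X u -> usc_on X (EFin \o u).
Proof.
move=> cu z Xz; split; first exact: ltry.
move=> a; rewrite /= lte_fin => ua.
have au : 0 < a - u z by rewrite subr_gt0.
move/subspace_continuousP: cu => /(_ z Xz).
move=> /(@cvgrPdist_lt _ _ _ _ _ u (u z))/(_ _ au); apply: filterS => y /=.
by rewrite lte_fin ltr_distl => /andP[]; lra.
Qed.

Lemma usc_on_cont (S : topologicalType) (U : set S) (u : S -> R) :
  (forall x, U x -> {for x, continuous u}) -> usc_on U (EFin \o u).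
Proof.
move=> cu; apply: cont_within_usc; apply: continuous_in_subspaceT => x.
by rewrite inE; exact: cu.
Qed.

Lemma plurisubharmonic_real U u : cont_at U u ->
  plurisubharmonic U (EFin \o u) <-> psh_on U u.
Proof.
move=> cu; split=> [[_ sub] a b Uab|pu].
  have [_ /(_ 0 1 ltr01)] := sub a b.
  have Uc := disc_circle Uab.
  rewrite (@circle_mean_real _ _ _ (fun t => u (a + expi t *: b))); last first.
  - by move=> t _; rewrite /circle_point add0r mul1r.
  - exact: (circle_continuous cu).
  rewrite scale0r addr0 lee_fin; apply => z; rewrite subr0 => z1.
  exact: Uab.
split; first exact: usc_on_cont.
move=> a b; split.
  apply: usc_on_cont => z Uz; apply: (@continuous_comp _ _ _ (fun z : R[i] => a + z *: b) u).
    exact: line_continuous.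
  exact: cu.
move=> c r r0 disc.
have Uab (z : R[i]) : `|z| <= 1 -> U ((a + c *: b) + z *: (r%:C *: b)).
  move=> z1; rewrite scalerA -addrA -scalerDl; apply: disc.
  rewrite addrAC subrr add0r normrM.
  have -> : `|r%:C : R[i]| = r%:C by rewrite ger0_norm// lecR ltW.
  by rewrite ler_piMl// lecR ltW.
have Uc := disc_circle Uab.
rewrite (@circle_mean_real _ _ _ (fun t => u ((a + c *: b) + expi t *: (r%:C *: b)))).
- by rewrite lee_fin; exact: pu.
- exact: (circle_continuous cu).
- by move=> t _; rewrite /= /circle_point scalerA -addrA -scalerDl [_ * expi t]mulrC.
Qed.

Lemma PSHoP X (v : T -> \bar R) : PSHo X v <->
  exists U u, [/\ open U, X `<=` U, cont_at U u, psh_on U u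
    & forall x, X x -> v x = (u x)%:E].
Proof.
split=> [[U [u' [oU XU pu [fu cu] uv]]]|[U [u [oU XU cu pu uv]]]].
  have cu' : cont_at U (fine \o u').
    by move=> x Ux; move: cu; rewrite continuous_open_subspace// => /(_ x); rewrite inE; apply.
  have fE x : U x -> u' x = ((fine \o u') x)%:E by move=> Ux; rewrite /= fineK// fu.
  exists U, (fine \o u'); split => //; last by move=> x Xx; rewrite -uv// fE//; exact: XU.
  move=> a b Uab; have Uc := disc_circle Uab.
  have Ua : U a by have := Uab 0; rewrite normr0 scale0r addr0; apply.
  have [_ sub] := pu; have [_ /(_ 0 1 ltr01)] := sub a b.
  rewrite (@circle_mean_real _ _ _ (fun t => fine (u' (a + expi t *: b)))); last first.
  - by move=> t _; rewrite /circle_point add0r mul1r; exact: (fE _ (Uc t)).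
  - exact: (@circle_continuous _ _ U (fine \o u') a b cu' Uc).
  rewrite scale0r addr0 fE// lee_fin; apply => z; rewrite subr0 => z1.
  exact: Uab.
exists U, (EFin \o u); split => //.
- by apply/plurisubharmonic_real.
- by split => //; apply: continuous_in_subspaceT => x; rewrite inE; exact: cu.
- by move=> x Xx; rewrite uv.
Qed.

(** [PSHo X] as a cone of real-valued functions, the form required by Edwards'
    theorem. *)
Definition psho X : set (T -> R) := [set u : T -> R | PSHo X (EFin \o u)].

Lemma psho_intro X U u : open U -> X `<=` U -> cont_at U u -> psh_on U u -> psho X u.
Proof. by move=> oU XU cu pu; apply/PSHoP; exists U, u. Qed.

Lemma psho_elim X u : psho X u -> exists U u',
  [/\ open U, X `<=` U, cont_at U u', psh_on U u' & forall x, X x -> u x = u' x].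
Proof.
move=> /PSHoP[U [u' [oU XU cu pu uu']]]; exists U, u'; split => // x Xx.
by have := uu' x Xx => -[].
Qed.

Lemma psho_ext X u v : (forall x, X x -> u x = v x) -> psho X u -> psho X v.
Proof.
move=> uv /PSHoP[U [u' [oU XU cu pu uu']]]; apply/PSHoP; exists U, u'; split => // x Xx.
by rewrite /= -uv//; exact: uu'.
Qed.

Lemma psho_cont X u : psho X u -> cont_within X u.
Proof.
move=> /psho_elim[U [u' [oU XU cu pu uu']]].
apply: (@cont_within_eq _ _ _ u'); first by move=> x Xx; rewrite uu'.
by apply: continuous_in_subspaceT => x; rewrite inE => Xx; apply: cu; exact: XU.
Qed.

Lemma psho_cst X c : psho X (fun=> c).
Proof.
apply: (@psho_intro X setT) => //; [exact: openT|exact: cont_at_cst|exact: psh_on_cst].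
Qed.

Lemma psho_binop X u v (op : R -> R -> R) :
  (forall U u v, cont_at U u -> cont_at U v -> cont_at U (fun x : T => op (u x) (v x))) ->
  (forall U u v, cont_at U u -> cont_at U v -> psh_on U u -> psh_on U v ->
    psh_on U (fun x : T => op (u x) (v x))) ->
  psho X u -> psho X v -> psho X (fun x => op (u x) (v x)).
Proof.
move=> cop pop /psho_elim[U [u' [oU XU cu pu uu']]] /psho_elim[W [v' [oW XW cv pv vv']]].
have UWl : U `&` W `<=` U by move=> x [].
have UWr : U `&` W `<=` W by move=> x [].
apply: (@psho_ext X (fun x => op (u' x) (v' x))).
  by move=> x Xx; rewrite uu'// vv'.
have cu' := cont_atS UWl cu; have cv' := cont_atS UWr cv.
apply: (@psho_intro X (U `&` W)).
- exact: openI.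
- by move=> x Xx; split; [exact: XU|exact: XW].
- exact: cop.
- by apply: pop => //; [exact: psh_onS pu|exact: psh_onS pv].
Qed.

Lemma pshoD X u v : psho X u -> psho X v -> psho X (fun x => u x + v x).
Proof.
by apply: (@psho_binop X u v (fun a b => a + b)) => *; [exact: cont_atD|exact: psh_onD].
Qed.

Lemma psho_max X u v : psho X u -> psho X v -> psho X (fun x => Num.max (u x) (v x)).
Proof.
by apply: (@psho_binop X u v (fun a b => Num.max a b)) => *;
  [exact: cont_at_max|exact: psh_on_max].
Qed.

Lemma pshoZ X c u : 0 <= c -> psho X u -> psho X (fun x => c * u x).
Proof.
move=> c0 pu; apply: (@psho_binop X u u (fun a _ => c * a) _ _ pu pu).
- by move=> U w _ cw _; exact: cont_atZ.
- by move=> U w _ cw _ pw _; exact: psh_onZ.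
Qed.

Lemma pshoS X Y u : Y `<=` X -> psho X u -> psho Y u.
Proof.
move=> YX [U [u' [oU XU pu cu uu']]]; exists U, u'; split => //.
  exact: subset_trans YX XU.
by move=> x /YX; exact: uu'.
Qed.

Lemma integral_cont_within X (mu : probability (@borelC R n) R) u :
  compact X -> closed X -> cont_within X u ->
  (\int[mu]_(x in X) (u x)%:E = (Rintegral mu (X : set (@borelC R n)) u)%:E)%E.
Proof.
move=> cX clX cu; rewrite /Rintegral fineK//.
by apply: integrable_fin_num; [exact: borel_closed|exact: cont_within_integrable].
Qed.

(** The measures occurring in Edwards' theorem for the cone [psho X] are the
    Jensen measures on [X], against which [g] satisfies the Jensen inequality by
    definition. *)
Theorem PSH_approx X (g : T -> R) (e : R) : compact X -> closed X -> cont_within X g ->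
  PSH X (EFin \o g) -> 0 < e ->
  exists u, psho X u /\ forall x, X x -> u x <= g x /\ g x < u x + e.
Proof.
move=> cX clX cg [_ Jg] e0.
apply: (@edwards R T (@cozero R T) X cX clX (psho X) (@psho_cont X) (psho_cst X)
  (@pshoD X) (fun c u c0 => pshoZ (ltW c0)) (@psho_max X) g e cg e0).
move=> z mu Xz [muX mureg muS].
pose nu : probability (@borelC R n) R := mu.
have : jensen_measure X z nu.
  split => // u /PSHoP[U [u' [oU XU cu pu uu']]].
  have pu' : psho X u' by apply: (@psho_intro X U).
  have -> : (\int[nu]_(x in X) u x = \int[nu]_(x in X) (u' x)%:E)%E.
    by apply: eq_integral => x; rewrite inE; exact: uu'.
  by rewrite uu'// integral_cont_within//; [rewrite lee_fin; exact: muS|exact: psho_cont].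
by move=> /(Jg z nu Xz); rewrite integral_cont_within// lee_fin.
Qed.

End PshCompact.

(** * Integration of upper semicontinuous functions *)

Section UscIntegral.
Context {R : realType} {n : nat}.
Notation T := 'rV[R[i]]_n.
Notation borel := (@borelC R n).

Lemma usc_measurable (X : set T) (v : T -> \bar R) : closed X -> usc_on X v ->
  measurable_fun (X : set borel) v.
Proof.
move=> clX uv mX.
apply: (measurability _ (measurable_realfun.ErealGenInftyO.measurableE R)) => //.
move=> _ [_ [a ->] <-].
have [W [oW XW]] : exists W : set T, open W /\ X `&` v @^-1` `]-oo, a%:E[%classic = X `&` W.
  exists (interior [set y | X y -> (v y < a%:E)%E]); split; first exact: open_interior.
  apply/seteqP; split=> x /= [Xx].
    rewrite in_itv/= => va; split => //.
    by have [_ /(_ a va)] := uv x Xx.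
  by move=> /nbhs_singleton /= /(_ Xx) va; split => //; rewrite in_itv.
rewrite XW; apply: measurableI; first exact: mX.
exact: sub_sigma_algebra.
Qed.

Lemma integral_null_part (mu : probability borel R) (X Y : set T) (v : T -> \bar R) :
  closed X -> usc_on X v -> measurable (Y : set borel) -> mu Y = 0%E ->
  (\int[mu]_(x in X) v x = \int[mu]_(x in X `\` Y) v x)%E.
Proof.
move=> clX uv mY muY; have mX : measurable (X : set borel) by exact: borel_closed.
have mv := usc_measurable clX uv.
rewrite [LHS]integralE [RHS]integralE; congr (_ - _)%E.
- by apply: ge0_negligible_integral => //; exact: measurable_funepos.
- by apply: ge0_negligible_integral => //; exact: measurable_funeneg.
Qed.

Lemma PSH_ext (X : set T) (u v : T -> \bar R) :
  (forall x, X x -> u x = v x) -> PSH X u -> PSH X v.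
Proof.
move=> uv [uscu Ju]; split.
  move=> z Xz; have [uz ua] := uscu z Xz; rewrite -uv//; split => // a va.
  have H := ua a va; near=> y; rewrite -uv; last by near: y; exact: withinT.
  by near: y.
move=> z mu Xz Jz; rewrite -uv// -(_ : \int[mu]_(x in X) u x = \int[mu]_(x in X) v x)%E.
  exact: Ju.
by apply: eq_integral => x; rewrite inE; exact: uv.
Unshelve. all: by end_near. Qed.

Lemma usc_onS (X Y : set T) (v : T -> \bar R) : Y `<=` X -> usc_on X v -> usc_on Y v.
Proof.
move=> YX uv z Yz; have [vz va] := uv z (YX z Yz); split => // a vza.
have H : nbhs z (fun y => X y -> (v y < a%:E)%E) := va a vza.
change (nbhs z (fun y => Y y -> (v y < a%:E)%E)).
by apply: filterS H => y h /YX.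
Qed.

Lemma PSH_uniform_limit (X : set T) (v : T -> R) : compact X -> closed X ->
  (forall e, 0 < e -> exists w, psho X w /\ forall x, X x -> w x <= v x <= w x + e) ->
  cont_within X v /\ PSH X (EFin \o v).
Proof.
move=> cX clX lim.
have cv : cont_within X v.
  apply/subspace_continuousP => x Xx; apply/cvgrPdist_lt => e e0.
  have e3 : 0 < e / 3 by rewrite divr_gt0.
  have [w [pw wv]] := lim _ e3.
  have /subspace_continuousP/(_ x Xx) := psho_cont pw.
  move=> /(@cvgrPdist_lt _ _ _ _ _ w (w x))/(_ _ e3) H.
  near=> y; have Xy : X y by near: y; exact: withinT.
  have : `|w x - w y| < e / 3 by near: y.
  have /andP[h1 h2] := wv x Xx; have /andP[h3 h4] := wv y Xy.
  rewrite /from_subspace !ltr_distl => /andP[h5 h6].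
  by apply/andP; split; lra.
split => //; split; first exact: cont_within_usc.
move=> z mu Xz Jz; apply/lee_addgt0Pr => e e0.
have [w [pw wv]] := lim _ e0; have cw := psho_cont pw.
have /andP[_ vz] := wv z Xz.
have [_ _ /(_ _ pw) Jw] := Jz.
apply: (@le_trans _ _ ((w z)%:E + e%:E)%E); first by rewrite -EFinD lee_fin.
rewrite leeD2r//; apply: (le_trans Jw).
rewrite !integral_cont_within// lee_fin; apply: le_Rintegral.
- exact: borel_closed.
- exact: cont_within_integrable.
- exact: cont_within_integrable.
- by move=> x Xx; have /andP[] := wv x Xx.
Unshelve. all: by end_near. Qed.

End UscIntegral.

(** * Jensen measures and the boundary of a domain *)

Section Hyperconvex.
Context {R : realType} {n : nat}.
Notation T := 'rV[R[i]]_n.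
Notation borel := (@borelC R n).
Variables (Omega : set T).
Hypotheses (oO : open Omega) (cO : connected Omega) (bO : bounded_set Omega).
Notation K := (closure Omega).
Notation bd := (boundary Omega).

Let clK : closed K. Proof. exact: closed_closure. Qed.

Let cK : compact K.
Proof.
apply: bounded_closed_compact_complex; last exact: closed_closure.
have [M [Mr OM]] := bO; exists M; split => // N MN.
have NR : N = (complex.Re N)%:C.
  rewrite RRe_real// -(subrK M N); apply: realD => //; apply: gtr0_real.
  by rewrite subr_gt0.
have leN (x : T) : (`|x| <= N) = (rnorm x <= complex.Re N).
  by rewrite rnormE [in LHS]NR lecR.
have -> : [set x : T | `|x| <= N] = @rnorm R T @^-1` [set y | y <= complex.Re N].
  by apply/seteqP; split => x /=; rewrite leN.
apply: closure_sub_closed.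
  by move/continuous_closedP: (@rnorm_continuous R T); apply; exact: closed_le.
by move=> x /(OM N MN) /=; rewrite leN.
Qed.

Let OmegaK : Omega `<=` K. Proof. exact: subset_closure. Qed.

Let bdE : bd = K `\` Omega.
Proof. by rewrite /boundary (interior_id Omega).1. Qed.

Let clbd : closed bd.
Proof. by rewrite bdE setDE; apply: closedI => //; exact: open_closedC. Qed.

Let bdK : bd `<=` K. Proof. by rewrite bdE => x []. Qed.

Let cbd : compact bd. Proof. exact: subclosed_compact bdK. Qed.

Let K_cases x : K x -> bd x \/ Omega x.
Proof.
by move=> Kx; have [Ox|nOx] := pselect (Omega x); [right|left; rewrite bdE].
Qed.

Let bd_notO x : bd x -> ~ Omega x.
Proof. by rewrite bdE => -[]. Qed.

(** Plurisubharmonicity of the approximants passes to the limit in the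
    submean inequality. *)
Lemma PSH_psh_on (g : T -> R) : cont_within K g -> PSH K (EFin \o g) -> psh_on Omega g.
Proof.
move=> cg pg a b Oab; have Oc := disc_circle Oab.
have Oa : Omega a by have := Oab 0; rewrite normr0 scale0r addr0; apply.
have cgO := cont_within_open oO OmegaK cg.
apply/ler_addgt0Pr => e e0.
have [u [/psho_elim[U [u' [oU KU cu pu uu']]] ug]] := PSH_approx cK clK cg pg e0.
have OU : Omega `<=` U := subset_trans OmegaK KU.
have [_ /ltW ga] := ug a (OmegaK Oa); apply: (le_trans ga).
rewrite lerD2r uu'//; last exact: OmegaK.
apply: (le_trans (psh_onS OU pu Oab)).
apply: mean_le.
- exact: (circle_continuous (cont_atS OU cu)).
- exact: (circle_continuous cgO).
- by move=> t; rewrite -uu'; [have [] := ug _ (OmegaK (Oc t))|exact: OmegaK (Oc t)].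
Qed.

(** The set of [Omega] where [g] takes the value [m] is closed in [Omega], and
    open because [g] is constant on every small circle around its points. *)
Lemma psh_lt_max (g : T -> R) (m : R) : cont_within K g -> psh_on Omega g ->
  (forall x, K x -> g x <= m) -> (exists2 x, K x & g x < m) ->
  forall x, Omega x -> g x < m.
Proof.
move=> cg pg gm [y Ky gy] x Ox; rewrite lt_neqAle gm ?andbT; last exact: OmegaK.
apply/negP => /eqP gx; pose B := [set z | Omega z /\ g z = m].
have cgO := cont_within_open oO OmegaK cg.
have oB : open B.
  rewrite openE => z [Oz gz].
  have /nbhs_rnorm[e e0 eO] : nbhs z Omega by exact: open_nbhs_nbhs.
  apply/nbhs_rnorm; exists e => // z' zz'; split; first exact: eO.
  have disc (w : R[i]) : `|w| <= 1 -> Omega (z + w *: (z' - z)).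
    rewrite rnormE lecR => w1; apply: eO; rewrite opprD addNKr rnormN rnormZ.
    by rewrite (le_lt_trans (ler_piMl (rnorm_ge0 _) w1))// rnormB.
  have Oc := disc_circle disc.
  have cG := circle_continuous cgO Oc.
  have mG : m <= mean (fun t => g (z + expi t *: (z' - z))) by rewrite -gz; exact: pg.
  have := mean_eq_max cG (fun t => gm _ (OmegaK (Oc t))) mG.
  move=> /(_ 0); rewrite expi0 scale1r (addrC z) subrK; apply.
  by rewrite lexx mulr_ge0// pi_ge0.
have BO : B = Omega.
  apply: cO; first by exists x.
    by exists B => //; rewrite setIidr// => z [].
  exists [set z | K z /\ m <= g z]; first exact: cont_within_closed_ge.
  apply/seteqP; split=> z [Oz] => [gz|[Kz mg]].
    split; first exact: Oz.
    by split; [exact: OmegaK|rewrite gz lexx].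
  split; first exact: Oz.
  by apply/eqP; rewrite eq_le mg andbT; exact: gm.
have : K `<=` [set z | K z /\ m <= g z].
  apply: closure_sub_closed; first exact: cont_within_closed_ge.
  move=> z; rewrite -{1}BO => -[Oz gz]; split; first exact: OmegaK.
  by rewrite gz lexx.
by move=> /(_ y Ky)[_]; rewrite leNgt gy.
Qed.

Let mK : measurable (K : set borel).
Proof. exact: (borel_closed clK). Qed.

Let mOmega : measurable (Omega : set borel).
Proof. exact: sub_sigma_algebra. Qed.

Let mbd : measurable (bd : set borel).
Proof. exact: (borel_closed clbd). Qed.

Lemma measure_closure (mu : probability borel R) : (mu K = mu bd + mu Omega)%E.
Proof.
have : mu K = (mu (K `\` Omega) + mu (K `&` Omega))%E := measureDI mu mK mOmega.
by rewrite -bdE setIidr.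
Qed.

Lemma integral_boundary (mu : probability borel R) (v : T -> \bar R) :
  usc_on K v -> mu Omega = 0%E ->
  (\int[mu]_(x in K) v x = \int[mu]_(x in bd) v x)%E.
Proof. by move=> uv mu0; rewrite (integral_null_part clK uv mOmega mu0) bdE. Qed.

(** A function plurisubharmonic near [K] is plurisubharmonic near [bd]. *)
Lemma jensen_extend (mu : probability borel R) z : bd z -> jensen_measure bd z mu ->
  jensen_measure K z mu /\ mu Omega = 0%E.
Proof.
move=> bz [mu1 mureg J].
have mu0 : mu Omega = 0%E.
  apply/eqP; rewrite eq_le measure_ge0 andbT.
  have := probability_le1 mu mK; rewrite measure_closure mu1.
  by rewrite -[X in (_ <= X)%E]adde0 leeD2lE.
split => //; split => //; first by rewrite measure_closure mu1 mu0 adde0.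
move=> u /PSHoP[U [u' [oU KU cu pu uu']]].
have pu' : psho K u' by exact: (psho_intro oU).
have -> : (\int[mu]_(x in K) u x = \int[mu]_(x in K) (u' x)%:E)%E.
  by apply: eq_integral => x; rewrite inE; exact: uu'.
rewrite (integral_boundary (cont_within_usc (psho_cont pu')) mu0).
rewrite uu'; last exact: bdK.
exact: (J _ (pshoS bdK pu')).
Qed.

Lemma PSH_boundary (v : T -> \bar R) : PSH K v -> PSH bd v.
Proof.
move=> [uv Jv]; split; first exact: usc_onS uv.
move=> z mu bz /(jensen_extend bz)[Jz mu0].
by rewrite -integral_boundary//; apply: Jv => //; exact: bdK.
Qed.

Section Phi.
Variable phi : T -> R.
Hypotheses (cphi : cont_within K phi) (pphi : PSH K (EFin \o phi))
  (phi_nc : exists x y, [/\ K x, K y & phi x <> phi y])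
  (phi0 : forall x, bd x -> phi x = 0).

Lemma phi_lt0 x : Omega x -> phi x < 0.
Proof.
have [a [b [Ka Kb ab]]] := phi_nc.
have [c cK' cmax] := compact_EVT_max (ex_intro _ a Ka) cK cphi.
rewrite inE in cK'.
have le_c z : K z -> phi z <= phi c by move=> Kz; apply: cmax; rewrite inE.
have lt_c : exists2 z, K z & phi z < phi c.
  have [ac|ac] := eqVneq (phi a) (phi c).
    by exists b => //; rewrite lt_neqAle le_c// andbT -ac eq_sym; exact/eqP.
  by exists a => //; rewrite lt_neqAle ac le_c.
have lt_O := psh_lt_max cphi (PSH_psh_on cphi pphi) le_c lt_c.
have [bc|/lt_O] := K_cases cK'; last by rewrite ltxx.
by rewrite -(phi0 bc); exact: lt_O.
Qed.

Lemma phi_le0 x : K x -> phi x <= 0.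
Proof. by move=> /K_cases[/phi0->//|/phi_lt0/ltW]. Qed.

(** The Jensen inequality for [phi] at [z] reads [0 <= \int phi], while [phi]
    vanishes on the boundary and is negative in [Omega]. *)
Lemma jensen_boundary (mu : probability borel R) z : bd z -> jensen_measure K z mu ->
  mu Omega = 0%E.
Proof.
move=> bz Jz; have [_ Jphi] := pphi.
have := Jphi z mu (bdK bz) Jz; rewrite /= phi0// => int_ge0.
have mphi : measurable_fun (K : set borel) (EFin \o phi).
  exact: (usc_measurable clK (cont_within_usc cphi)).
have : (\int[mu]_(x in K) `|(phi x)%:E| = 0)%E.
  have -> : (\int[mu]_(x in K) `|(phi x)%:E| = \int[mu]_(x in K) (-1 * phi x)%:E)%E.
    apply: eq_integral => x; rewrite inE => Kx; rewrite mulN1r lee0_abs// lee_fin.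
    exact: phi_le0.
  have cN := cont_withinZ (-1) cphi.
  have iphi := cont_within_integrable cK clK mu cphi.
  move: int_ge0; rewrite !integral_cont_within// (RintegralZl _ mK iphi) lee_fin => int_ge0.
  have : 0 <= Rintegral mu (K : set borel) (fun x => -1 * phi x).
    by apply: Rintegral_ge0 => x Kx; rewrite mulN1r oppr_ge0 phi_le0.
  rewrite (RintegralZl _ mK iphi) => int_le0.
  by congr (_%:E); lra.
have [H _] := ae_eq_integral_abs mu mK mphi.
move=> int0; have [N [mN muN KN]] := H int0.
apply/eqP; rewrite eq_le measure_ge0 andbT -muN.
apply: le_measure; [by rewrite inE; exact: mOmega|by rewrite inE|].
move=> x Ox; apply: KN => /= /(_ (OmegaK Ox)) [] px.
by have := phi_lt0 Ox; rewrite px ltxx.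
Qed.
Lemma phi_gap (Z : set T) : closed Z -> Z `<=` Omega ->
  exists2 eta, 0 < eta & forall x, Z x -> phi x <= - eta.
Proof.
move=> clZ ZO; have ZK : Z `<=` K := subset_trans ZO OmegaK.
have cZ : compact Z := subclosed_compact clZ cK ZK.
have [Z0|Z0] := pselect (Z !=set0); last first.
  by exists 1 => // x Zx; exfalso; apply: Z0; exists x.
have [c cZ' cmax] := compact_EVT_max Z0 cZ (continuous_subspaceW ZK cphi).
rewrite inE in cZ'; exists (- phi c); first by rewrite oppr_gt0 phi_lt0//; exact: ZO.
by move=> x Zx; rewrite opprK cmax// inE.
Qed.

(** Near the boundary add to [u] a large multiple of an approximant [f] of [phi].
    Away from it the sum drops below a constant [c] smaller than every boundary
    value, so its maximum with [c] extends by the constant [c]. *)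
Lemma extend_from_boundary (u : T -> R) (e : R) : psho bd u -> 0 < e ->
  exists w, psho K w /\ forall x, bd x -> w x <= u x <= w x + e.
Proof.
move=> /psho_elim[U [u' [oU bU cu pu uu']]] e0.
have [bd0|bd0] := pselect (bd !=set0); last first.
  by exists (fun=> 0); split; [exact: psho_cst|move=> x bx; exfalso; apply: bd0; exists x].
have [rho [crho rhoP]] := cozero oU.
have [b bb bmin] := compact_EVT_min bd0 cbd (cont_withinW crho).
rewrite inE in bb; pose r := rho b.
have r0 : 0 < r by have [_ ->] := rhoP b; exact: bU.
have rho_bd x : bd x -> r <= rho x by move=> bx; apply: bmin; rewrite inE.
have rhoU x : 0 < rho x -> U x by have [_ [+ _]] := rhoP x.
pose L := [set x | K x /\ r / 4 <= rho x].
have clL : closed L by apply: cont_within_closed_ge => //; exact: cont_withinW.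
have LU : L `<=` U by move=> x [_ rx]; apply: rhoU; lra.
have cL : compact L by apply: (subclosed_compact clL cK) => x [].
have cuL : cont_within L u' by apply: continuous_in_subspaceT => x; rewrite inE => /LU; exact: cu.
have [N0 uN0] := cont_within_bounded cL cuL.
pose N := `|N0|; have N_ge0 : 0 <= N by exact: normr_ge0.
have uN x : L x -> - N <= u' x <= N.
  by move=> Lx; rewrite -ler_norml (le_trans (uN0 x Lx))// ler_norm.
pose L2 := [set x | K x /\ - (r / 2) <= - rho x].
have clL2 : closed L2.
  by apply: cont_within_closed_ge => //; apply: cont_withinN; exact: cont_withinW.
have L2O : L2 `<=` Omega.
  move=> x [Kx rx]; have [bx|//] := K_cases Kx.
  by have := rho_bd x bx; lra.
have [eta eta0 phi_eta] := phi_gap clL2 L2O.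
(* [M * eta] exceeds [N - c], so that [u' + M * f] is below [c] where [u' <= N]
   and [phi <= - eta]. *)
pose M := (2 * N + 2) / eta.
have M0 : 0 < M by apply: divr_gt0 => //; lra.
have Meta : M * eta = 2 * N + 2 by rewrite /M divfK// gt_eqF.
pose d := Num.min e (1 / 2) / M.
have d0 : 0 < d by apply: divr_gt0 => //; rewrite lt_min e0/=; lra.
have MdE : M * d = Num.min e (1 / 2) by rewrite mulrC divfK// gt_eqF.
have Mde : M * d <= e by rewrite MdE ge_min lexx.
have Md1 : M * d <= 1 / 2 by rewrite MdE ge_min lexx orbT.
have [f0 [/psho_elim[W [f [oW KW cf pf ff]]] f0phi]] := PSH_approx cK clK cphi pphi d0.
have fphi x : K x -> f x <= phi x /\ phi x < f x + d.
  by move=> Kx; rewrite -ff//; exact: f0phi.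
pose c := - N - 1.
pose g x := u' x + M * f x.
have UWl : U `&` W `<=` U by move=> x [].
have UWr : U `&` W `<=` W by move=> x [].
have cg : cont_at (U `&` W) g.
  by apply: cont_atD; [exact: cont_atS cu|apply: cont_atZ; exact: cont_atS cf].
have pg : psh_on (U `&` W) g.
  have cf' := cont_atS UWr cf.
  apply: psh_onD; [exact: cont_atS cu|exact: cont_atZ|exact: psh_onS pu|].
  by apply: psh_onZ; [exact: ltW|exact: cf'|exact: psh_onS pf].
(* The threshold [r / 3] lies between [r / 4], above which [u'] is bounded by [N],
   and [r / 2], below which [phi <= - eta]; around points at the threshold both
   bounds hold, and [g < c]. *)
pose w x := if r / 3 < rho x then Num.max (g x) c else c.
pose O1 := [set x | r / 3 < rho x] `&` W.
have oO1 : open O1.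
  apply: openI => //; move/continuousP: crho => /(_ _ (@open_gt R (r / 3))).
  by [].
pose O2 := interior [set x | w x = c].
have oO2 : open O2 by exact: open_interior.
have O1UW : O1 `<=` U `&` W by move=> x [/= rx Wx]; split => //; apply: rhoU; lra.
have cg1 := cont_atS O1UW cg; have pg1 := psh_onS O1UW pg.
have wO1 x : O1 x -> Num.max (g x) c = w x by move=> [/= rx _]; rewrite /w rx.
have wO2 x : O2 x -> c = w x by move=> /interior_subset /= ->.
have cw1 : cont_at O1 w.
  apply: (cont_at_eq oO1 wO1); apply: cont_at_max => //; exact: cont_at_cst.
have cw2 : cont_at O2 w by apply: (cont_at_eq oO2 wO2); exact: cont_at_cst.
have pw1 : psh_on O1 w.
  apply: (psh_on_eq wO1); apply: psh_on_max => //; [exact: cont_at_cst|exact: psh_on_cst].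
have pw2 : psh_on O2 w by apply: (psh_on_eq wO2); exact: psh_on_cst.
have oD : open (O1 `|` O2) by exact: openU.
have KD : K `<=` O1 `|` O2.
  move=> x Kx; have [rx|rx] := ltP (r / 3) (rho x).
    by left; split => //; exact: KW.
  right; rewrite /O2 /interior /=.
  have [rx4|rx4] := ltP (rho x) (r / 3).
    have : \forall y \near x, rho y < r / 3.
      apply: open_nbhs_nbhs; split => //.
      by move/continuousP: crho => /(_ _ (@open_lt R (r / 3))).
    by apply: filterS => y /= yr; rewrite /w ltNge (ltW yr).
  have Lx : L x by split => //; lra.
  have L2x : L2 x by split => //; lra.
  have gx : g x < c.
    have /andP[_ ux] := uN x Lx; have [fx _] := fphi x Kx.
    have : M * f x <= M * - eta by rewrite ler_pM2l// (le_trans fx)// phi_eta.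
    by rewrite mulrN Meta /g /c; move: ux; lra.
  have UWx : (U `&` W) x by split; [exact: LU|exact: KW].
  have cgx : 0 < c - g x by rewrite subr_gt0.
  have /(@cvgrPdist_lt _ _ _ _ _ g (g x))/(_ _ cgx) := cg x UWx.
  apply: filterS => y /=; rewrite ltr_distl => /andP[gy _].
  have {}gy : g y <= c by move: gy; lra.
  by rewrite /= /w; case: ifP => // _; rewrite max_r.
exists w; split.
  apply: (@psho_intro _ _ K (O1 `|` O2)) => //.
    by move=> x [/cw1|/cw2].
  apply: psh_on_local; first by move=> x [/cw1|/cw2].
  by move=> x [h|h]; [exists O1|exists O2].
move=> x bx; have Kx := bdK bx.
have rx := rho_bd x bx.
have Lx : L x by split => //; lra.
have [fx1 fx2] := fphi x Kx; rewrite phi0// in fx1 fx2.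
have Mf1 : M * f x <= 0 by rewrite pmulr_rle0.
have Mf2 : - (M * d) <= M * f x by rewrite -mulrN ler_pM2l//; lra.
have /andP[ux _] := uN x Lx.
rewrite -wO1; last by split; [rewrite /=; lra|exact: KW].
rewrite uu'// max_l; last by rewrite /g /c; lra.
by rewrite /g; apply/andP; split; lra.
Qed.

(** Two facts combine: the measure lives on the boundary, and there the functions
    of [psho bd] are uniform limits of restrictions of functions of [psho K]. *)
Lemma jensen_restrict (mu : probability borel R) z : bd z -> jensen_measure K z mu ->
  jensen_measure bd z mu.
Proof.
move=> bz Jz; have mu0 := jensen_boundary bz Jz; have [mu1 mureg J] := Jz.
split => //; first by rewrite -mu1 measure_closure mu0 adde0.
move=> u /PSHoP[U [u' [oU bU cu pu uu']]].
have pu' : psho bd u' by exact: (psho_intro oU).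
have -> : (\int[mu]_(x in bd) u x = \int[mu]_(x in bd) (u' x)%:E)%E.
  by apply: eq_integral => x; rewrite inE; exact: uu'.
rewrite uu'//; apply/lee_addgt0Pr => e e0.
have [w [pw wu]] := extend_from_boundary pu' e0.
have cw := psho_cont pw; have /andP[_ uz] := wu z bz.
apply: (@le_trans _ _ ((w z)%:E + e%:E)%E); first by rewrite -EFinD lee_fin.
rewrite leeD2r//; apply: (le_trans (J _ pw)).
rewrite (integral_boundary (cont_within_usc cw) mu0).
have cwb : cont_within bd w := continuous_subspaceW bdK cw.
have cub := psho_cont pu'.
rewrite !integral_cont_within// lee_fin; apply: le_Rintegral.
- exact: mbd.
- exact: cont_within_integrable.
- exact: cont_within_integrable.
- by move=> x bx; have /andP[] := wu x bx.
Qed.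

(** The value [-oo] in the open set [Omega] preserves upper semicontinuity and
    makes the Jensen inequality trivial at interior points. *)
Lemma PSH_boundary_extension (f : T -> \bar R) : PSH bd f ->
  PSH K (fun x => if `[< Omega x >] then -oo%E else f x).
Proof.
move=> [uf Jf]; pose v x := if `[< Omega x >] then -oo%E else f x.
have vO x : Omega x -> v x = -oo%E by move=> Ox; rewrite /v asboolT.
have vbd x : bd x -> v x = f x by move=> bx; rewrite /v asboolF//; exact: bd_notO.
have uv : usc_on K v.
  move=> z /K_cases[bz|Oz].
    have [fz fa] := uf z bz; rewrite vbd//; split => // a fza.
    have H : nbhs z (fun y => bd y -> (f y < a%:E)%E) := fa a fza.
    change (nbhs z (fun y => K y -> (v y < a%:E)%E)).
    apply: filterS H => y fy Ky; have [by'|Oy] := K_cases Ky.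
      by rewrite vbd//; exact: fy.
    by rewrite vO// ltNyr.
  rewrite vO//; split => // a _; apply: cvg_within.
  have : nbhs z Omega by exact: open_nbhs_nbhs.
  by apply: filterS => y Oy; rewrite vO// ltNyr.
split => // z mu /K_cases[bz|Oz] Jz; last by rewrite -/(v z) vO// leNye.
have mu0 := jensen_boundary bz Jz.
rewrite (integral_boundary uv mu0) -/(v z) vbd//.
have -> : (\int[mu]_(x in bd) v x = \int[mu]_(x in bd) f x)%E.
  by apply: eq_integral => x; rewrite inE; exact: vbd.
by apply: Jf => //; exact: jensen_restrict.
Qed.

Section ContinuousData.
Variable f : T -> R.
Hypotheses (cf : cont_within bd f) (pf : PSH bd (EFin \o f)).

Let approx_below (v : T -> R) (e : R) : Prop :=
  psho K v /\ forall x, bd x -> v x <= f x /\ f x < v x + e.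

Lemma approx_data e : 0 < e -> exists w, approx_below w e.
Proof.
move=> e0; have e2 : 0 < e / 2 by rewrite divr_gt0.
have [u [pu uf]] := PSH_approx cbd clbd cf pf e2.
have [w [pw wu]] := extend_from_boundary pu e2.
exists w; split => // x bx; have [h1 h2] := uf x bx; have /andP[h3 h4] := wu x bx.
by split; lra.
Qed.

(** Let [w] approximate [f] within [e' / 2] on the boundary.  The set where [w]
    exceeds [v + e] is compact in [Omega], so a large multiple of an approximant
    [g] of [phi] pushes [w] below [v] there; the maximum with [v] then exceeds [v]
    by at most [e]. *)
Lemma refine_approx v e e' : approx_below v e -> 0 < e -> 0 < e' -> exists v',
  approx_below v' e' /\ forall x, K x -> v x <= v' x <= v x + e.
Proof.
move=> [pv vf] e0 e'0; have e2 : 0 < e' / 2 by rewrite divr_gt0.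
have [w [pw wf]] := approx_data e2.
have cwv : cont_within K (w \+ (\- v)).
  by apply: cont_withinD; [|apply: cont_withinN]; exact: psho_cont.
pose Z := [set x | K x /\ e <= w x + - v x].
have clZ : closed Z by exact: cont_within_closed_ge.
have ZO : Z `<=` Omega.
  move=> x [Kx ex]; have [bx|//] := K_cases Kx.
  by have [h1 h2] := vf x bx; have [h3 h4] := wf x bx; lra.
have [eta eta0 phi_eta] := phi_gap clZ ZO.
have [N0 wvN0] := cont_within_bounded cK cwv; pose N := `|N0|.
have N_ge0 : 0 <= N by exact: normr_ge0.
have wvN x : K x -> w x - v x <= N.
  by move=> Kx; rewrite (le_trans (ler_norm _))// (le_trans (wvN0 x Kx))// ler_norm.
pose M := (N + 1) / eta.
have M0 : 0 < M by apply: divr_gt0 => //; lra.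
have Meta : M * eta = N + 1 by rewrite /M divfK// gt_eqF.
pose d := (e' / 2) / M; have d0 : 0 < d by rewrite divr_gt0.
have Md : M * d = e' / 2 by rewrite mulrC divfK// gt_eqF.
have [g [pg gphi]] := PSH_approx cK clK cphi pphi d0.
have gle0 x : K x -> M * g x <= 0.
  by move=> Kx; rewrite pmulr_rle0//; have [h _] := gphi x Kx; rewrite (le_trans h)// phi_le0.
exists (fun x => Num.max (v x) (w x + M * g x)); split; last first.
  move=> x Kx; rewrite le_max lexx/= ge_max; apply/andP; split; first by rewrite lerDl ltW.
  have [ex|ex] := lerP e (w x + - v x); last by have := gle0 x Kx; lra.
  have gx : M * g x <= M * - eta.
    by rewrite ler_pM2l//; have [h _] := gphi x Kx; rewrite (le_trans h)// phi_eta.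
  by have := wvN x Kx; move: gx; rewrite mulrN Meta; lra.
split; first by apply: psho_max => //; apply: pshoD => //; apply: pshoZ => //; exact: ltW.
move=> x bx; have Kx := bdK bx; have [h1 h2] := vf x bx; have [h3 h4] := wf x bx.
have [h5 h6] := gphi x Kx; rewrite phi0// in h5 h6.
have h7 : - (M * d) <= M * g x by rewrite -mulrN ler_pM2l//; lra.
have h8 := gle0 x Kx; rewrite Md in h7.
split; first by rewrite ge_max h1/=; lra.
by rewrite -ltrBlDr lt_max; apply/orP; right; lra.
Qed.

(** Iterating [refine_approx] with the errors [2 ^ -k] gives an increasing sequence
    that converges uniformly on [K]. *)
Lemma continuous_boundary_extension : exists v : T -> R,
  [/\ cont_within K v, PSH K (EFin \o v) & forall x, bd x -> v x = f x].
Proof.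
pose e_ (k : nat) : R := 2^-1 ^+ k.
have e_gt0 k : 0 < e_ k by rewrite exprn_gt0 ?invr_gt0.
have e_S k : e_ k = e_ k.+1 + e_ k.+1 by rewrite /e_ exprS; field.
have step (p : nat * (T -> R)) : exists v', approx_below p.2 (e_ p.1) ->
    approx_below v' (e_ p.1.+1) /\ forall x, K x -> p.2 x <= v' x <= p.2 x + e_ p.1.
  have [pb|npb] := pselect (approx_below p.2 (e_ p.1)); last by exists p.2.
  by have [v' v'P] := refine_approx pb (e_gt0 p.1) (e_gt0 p.1.+1); exists v'.
have {step} /choice[next nextP] := step.
have [v0 v0P] := approx_data (e_gt0 0).
pose vs := fix vs (k : nat) := if k is k'.+1 then next (k', vs k') else v0.
have vsP k : approx_below (vs k) (e_ k).
  by elim: k => [//|k IH]; have [] := nextP (k, vs k) IH.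
have vs_step k x : K x -> vs k x <= vs k.+1 x <= vs k x + e_ k.
  by move=> Kx; have [_ /(_ x Kx)] := nextP (k, vs k) (vsP k).
have vs_le k j x : K x ->
    vs k x <= vs (k + j)%N x <= vs k x + (e_ k + e_ k) - (e_ (k + j)%N + e_ (k + j)%N).
  move=> Kx; elim: j => [|j /andP[h1 h2]].
    by rewrite addn0; apply/andP; split; lra.
  have /andP[h3 h4] := vs_step (k + j)%N x Kx; have h5 := e_S (k + j)%N.
  by rewrite addnS; apply/andP; split; lra.
pose v x := sup (range (fun k => vs k x)).
have v_sup x : K x -> has_sup (range (fun k => vs k x)).
  move=> Kx; split; first by exists (vs 0 x), 0.
  exists (vs 0 x + (e_ 0 + e_ 0)) => _ [k _ <-].
  by have /andP[_] := vs_le 0 k x Kx; have := e_gt0 k; rewrite add0n; lra.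
have vs_v k x : K x -> vs k x <= v x <= vs k x + (e_ k + e_ k).
  move=> Kx; apply/andP; split.
    by apply: sup_upper_bound; [exact: v_sup|exists k].
  apply: ge_sup; first by have [] := v_sup x Kx.
  move=> _ [j _ <-]; have [kj|/ltnW jk] := leqP k j.
    have /andP[_] := vs_le k (j - k)%N x Kx; rewrite subnKC//.
    by have := e_gt0 j; lra.
  have /andP[+ _] := vs_le j (k - j)%N x Kx; rewrite subnKC//.
  by have := e_gt0 k; lra.
have e_small e : 0 < e -> exists k, e_ k < e.
  move=> e0; have : \forall k \near \oo, e_ k < e.
    have : e_ @ \oo --> 0 by apply: cvg_expr; rewrite ger0_norm ?invr_ge0// invf_lt1// ltr1n.
    move=> /(@cvgrPdist_lt _ _ _ _ _ e_ 0)/(_ _ e0); apply: filterS => k.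
    by rewrite sub0r normrN ger0_norm// ltW.
  by move=> [k _ /(_ k (leqnn k))]; exists k.
have [cv pv] : cont_within K v /\ PSH K (EFin \o v).
  apply: PSH_uniform_limit => // e e0.
  have [k ke] := e_small _ (divr_gt0 e0 (ltr0Sn R 1)).
  exists (vs k); split; first by have [] := vsP k.
  by move=> x Kx; have /andP[h1 h2] := vs_v k x Kx; apply/andP; split; lra.
exists v; split => // x bx; have Kx := bdK bx; apply/eqP; rewrite eq_le; apply/andP; split.
  apply: ge_sup; first by have [] := v_sup x Kx.
  by move=> _ [k _ <-]; have [_ /(_ x bx)[]] := vsP k.
apply/ler_addgt0Pr => e /e_small[k ke].
have [_ /(_ x bx)[_ h]] := vsP k; have /andP[h1 _] := vs_v k x Kx.
by lra.
Qed.

End ContinuousData.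
End Phi.
End Hyperconvex.

Theorem theorem4 (R : realType) (n : nat) (Omega : set 'rV[R[i]]_n)
    (f : 'rV[R[i]]_n -> \bar R) :
  P_hyperconvex Omega ->
  (forall z, boundary Omega z -> (f z < +oo)%E) ->
  ((exists v, dirichlet_solution Omega f v) <-> PSH (boundary Omega) f) /\
  ((exists v, dirichlet_solution Omega f v) -> cont_on (boundary Omega) f ->
   exists v, dirichlet_solution Omega f v /\ cont_on (closure Omega) v).
Proof.
move=> [[oO cO _ bO] [phi [pphi [phi_fin cphi] [x [y [Kx Ky xy]]] phi0]]] _.
pose phi' := fine \o phi.
have phiE z : closure Omega z -> phi z = (EFin \o phi') z.
  by move=> Kz; rewrite /= fineK// phi_fin.
have pphi' : PSH (closure Omega) (EFin \o phi') := PSH_ext phiE pphi.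
have phi'_nc : exists x y, [/\ closure Omega x, closure Omega y & phi' x <> phi' y].
  by exists x, y; split => // h; apply: xy; rewrite !phiE//= h.
have phi'0 z : boundary Omega z -> phi' z = 0 by move=> bz; rewrite /phi' /= phi0.
have to_bd v : dirichlet_solution Omega f v -> PSH (boundary Omega) f.
  by move=> [pv vf]; apply: (PSH_ext vf); exact: PSH_boundary.
split.
  split=> [[v]|pf]; first exact: to_bd.
  exists (fun x => if `[< Omega x >] then -oo%E else f x); split.
    exact: (PSH_boundary_extension oO cO bO cphi pphi' phi'_nc phi'0).
  by move=> z [_ nz]; rewrite asboolF// -(interior_id Omega).1.
move=> [v /to_bd pf] [f_fin cf].
have fE z : boundary Omega z -> f z = (EFin \o (fine \o f)) z.
  by move=> bz; rewrite /= fineK// f_fin.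
have [w [cw pw wf]] := continuous_boundary_extension oO cO bO cphi pphi' phi'_nc phi'0
  cf (PSH_ext fE pf).
exists (EFin \o w); split; last by split.
by split => // z bz; rewrite fE//= wf.
Qed.
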